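(* Let $(M^3,\varphi,\xi,\eta,g)$ be a contact metric manifold of dimension three with Ricci operator $Q$. If $Q\xi=0$ on $M$, then $\operatorname{rank}Q\le 1$ (at every point of $M$). Consequently, either the metric $g$ is flat, or it is weakly Einstein but not Einstein.
   Context: All manifolds, vector fields and tensors are smooth. An almost contact metric structure on a smooth manifold $M^{2n+1}$ is a quadruple $(\varphi,\xi,\eta,g)$, where $\varphi$ is a $(1,1)$-tensor field, $\xi$ a vector field, $\eta$ a one-form and $g$ a Riemannian metric such that $\varphi^2=-I+\eta\otimes\xi$, $\eta(\xi)=1$ and $g(\varphi X,\varphi Y)=g(X,Y)-\eta(X)\eta(Y)$ for all vector fields $X,Y$. It is a contact metric structure if moreover $d\eta(X,Y)=g(X,\varphi Y)$ for all $X,Y$, where the exterior derivative is normalized by $d\eta(X,Y)=\frac12\{X\eta(Y)-Y\eta(X)-\eta([X,Y])\}$. Curvature convention: $R(X,Y)Z=\nabla_X\nabla_YZ-\nabla_Y\nabla_XZ-\nabla_{[X,Y]}Z$ with $\nabla$ the Levi-Civita connection, $R(X,Y,Z,W)=g(R(X,Y)Z,W)$. The Ricci tensor is $\rho(Y,Z)=\sum_i R(e_i,Y,Z,e_i)$ for an orthonormal frame $\{e_i\}$, and the Ricci operator $Q$ is defined by $g(QX,Y)=\rho(X,Y)$. A Riemannian manifold $(M^m,g)$ is weakly Einstein if $\breve R=\frac{|R|^2}{m}g$, where $\breve R(X,Y)=\sum_{i,j,k=1}^m R(X,e_i,e_j,e_k)R(Y,e_i,e_j,e_k)$ for a local orthonormal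 frame $\{e_i\}$ and $|R|^2=\sum_{i,j,k,l}R(e_i,e_j,e_k,e_l)^2$. *)

(* Defs.v *)
From HB Require Import structures.
From mathcomp Require Import all_boot all_order all_algebra.
From mathcomp Require Import all_classical all_reals all_analysis.

Set Implicit Arguments.
Unset Strict Implicit.
Unset Printing Implicit Defensive.

Import Order.TTheory GRing.Theory Num.Theory.
Import numFieldNormedType.Exports.

Local Open Scope classical_set_scope.
Local Open Scope ring_scope.

Fixpoint Ck (R : realType) (V W : normedModType R) (k : nat)
    (A : set V) (f : V -> W) : Prop :=
  match k with
  | 0 => forall x, A x -> {for x, continuous f}
  | k'.+1 => (forall x, A x -> differentiable f x) /\
             (forall v : V, Ck k' A ('D_v f))
  end.

(* Only meaningful for open [A]. *)
Definition Cinfty (R : realType) (V W : normedModType R)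
    (A : set V) (f : V -> W) : Prop :=
  forall k, Ck k A f.

(* [coord] and [chart_inv] are total; their values off [chart_dom] and off its
   image are irrelevant. *)
Record chart (R : realType) (T : topologicalType) (m : nat) := Chart {
  chart_dom : set T;
  coord : T -> 'cV[R]_m;
  chart_inv : 'cV[R]_m -> T;
  chart_dom_open : open chart_dom;
  chart_image_open : open (coord @` chart_dom);
  coordK : forall p, chart_dom p -> chart_inv (coord p) = p;
  coord_continuous : forall p, chart_dom p -> {for p, continuous coord};
  chart_inv_continuous :
    forall x, (coord @` chart_dom) x -> {for x, continuous chart_inv}
}.

(* The atlas need not be maximal.  [chart_at] plays no geometric role: it fixes
   the chart at [p] in which tangent vectors at [p] are written. *)
Record manifold (R : realType) (m : nat) := Manifold {
  mcarrier :> topologicalType;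
  mhausdorff : hausdorff_space mcarrier;
  msecond_countable : @second_countable mcarrier;
  atlas : set (chart R mcarrier m);
  chart_at : mcarrier -> chart R mcarrier m;
  chart_at_atlas : forall p, atlas (chart_at p);
  chart_at_dom : forall p, chart_dom (chart_at p) p;
  atlas_compatible : forall c d, atlas c -> atlas d ->
    Cinfty (coord c @` (chart_dom c `&` chart_dom d)) (coord d \o chart_inv c)
}.

(* The tangent space at p is 'cV[R]_m, an element being the components of a
   tangent vector in the chart [chart_at M p].  Thus a vector field is a map
   M -> 'cV[R]_m, a (1,1)-tensor field a map M -> 'M[R]_m, a one-form a map
   M -> 'rV[R]_m, and a bilinear form field is given by its Gram matrices.
   Local fields are total maps of which only the values on the open set under
   consideration matter. *)
Section Manifold.
Variables (R : realType) (m : nat) (M : manifold R m).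
Implicit Types (p q : M) (u v w z : 'cV[R]_m) (U : set M).
Implicit Types (X Y Z : M -> 'cV[R]_m).

Definition smooth_fun (W : normedModType R) U (f : M -> W) : Prop :=
  forall c, atlas c ->
    Cinfty (coord c @` (U `&` chart_dom c)) (f \o chart_inv c).

(* The derivative of f along the tangent vector v at p. *)
Definition tderiv (W : normedModType R) p v (f : M -> W) : W :=
  'D_v (f \o chart_inv (chart_at p)) (coord (chart_at p) p).

(* The components in the chart c of the tangent vector v at p. *)
Definition components (c : chart R M m) p v : 'cV[R]_m :=
  tderiv p v (coord c).

Definition smooth_field U X : Prop :=
  forall c, atlas c ->
    Cinfty (coord c @` (U `&` chart_dom c))
      (fun x => components c (chart_inv c x) (X (chart_inv c x))).

Definition fderiv X (f : M -> R) : M -> R := fun p => tderiv p (X p) f.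

(* [X,Y]^i = X(Y^i) - Y(X^i), components being taken in [chart_at M p]. *)
Definition lie X Y : M -> 'cV[R]_m := fun p =>
  tderiv p (X p) (fun q => components (chart_at p) q (Y q))
  - tderiv p (Y p) (fun q => components (chart_at p) q (X q)).

Definition gval (g : M -> 'M[R]_m) p u v : R := (u^T *m g p *m v) ord0 ord0.

Definition form_val (eta : M -> 'rV[R]_m) p v : R := (eta p *m v) ord0 ord0.

Record riemannian_metric (g : M -> 'M[R]_m) : Prop := RiemannianMetric {
  metric_sym : forall p u v, gval g p u v = gval g p v u;
  metric_pos : forall p u, u != 0 -> 0 < gval g p u u;
  metric_smooth : forall U X Y, open U -> smooth_field U X ->
    smooth_field U Y -> smooth_fun U (fun p => gval g p (X p) (Y p))
}.

Definition dform (eta : M -> 'rV[R]_m) X Y : M -> R := fun p =>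
  2^-1 * (fderiv X (fun q => form_val eta q (Y q)) p
          - fderiv Y (fun q => form_val eta q (X q)) p
          - form_val eta p (lie X Y p)).

Record almost_contact_metric (phi : M -> 'M[R]_m) (xi : M -> 'cV[R]_m)
    (eta : M -> 'rV[R]_m) (g : M -> 'M[R]_m) : Prop := AlmostContactMetric {
  acm_phi_smooth : forall U X, open U -> smooth_field U X ->
    smooth_field U (fun p => phi p *m X p);
  acm_xi_smooth : smooth_field setT xi;
  acm_eta_smooth : forall U X, open U -> smooth_field U X ->
    smooth_fun U (fun p => form_val eta p (X p));
  acm_metric : riemannian_metric g;
  acm_phi2 : forall p v,
    phi p *m (phi p *m v) = - v + form_val eta p v *: xi p;
  acm_eta_xi : forall p, form_val eta p (xi p) = 1;
  acm_compatible : forall p u v,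
    gval g p (phi p *m u) (phi p *m v)
    = gval g p u v - form_val eta p u * form_val eta p v
}.

Record contact_metric (phi : M -> 'M[R]_m) (xi : M -> 'cV[R]_m)
    (eta : M -> 'rV[R]_m) (g : M -> 'M[R]_m) : Prop := ContactMetric {
  cm_almost : almost_contact_metric phi xi eta g;
  cm_deta : forall U X Y, open U -> smooth_field U X -> smooth_field U Y ->
    forall p, U p -> dform eta X Y p = gval g p (X p) (phi p *m Y p)
}.

(* Since the axioms hold on every open U for functions and fields smooth on U
   only, they make nabla local: apply the Leibniz rule to the indicator function
   of a smaller open set. *)
Record levi_civita (g : M -> 'M[R]_m)
    (nabla : (M -> 'cV[R]_m) -> (M -> 'cV[R]_m) -> (M -> 'cV[R]_m)) : Prop :=
    LeviCivita {
  lc_smooth : forall U X Y, open U -> smooth_field U X -> smooth_field U Y ->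
    smooth_field U (nabla X Y);
  lc_linear : forall U (f : M -> R) X X' Y, open U -> smooth_fun U f ->
    smooth_field U X -> smooth_field U X' -> smooth_field U Y ->
    forall p, U p -> nabla (fun q => f q *: X q + X' q) Y p
                     = f p *: nabla X Y p + nabla X' Y p;
  lc_leibniz : forall U (f : M -> R) X Y Y', open U -> smooth_fun U f ->
    smooth_field U X -> smooth_field U Y -> smooth_field U Y' ->
    forall p, U p -> nabla X (fun q => f q *: Y q + Y' q) p
                     = fderiv X f p *: Y p + f p *: nabla X Y p + nabla X Y' p;
  lc_torsion_free : forall U X Y, open U ->
    smooth_field U X -> smooth_field U Y ->
    forall p, U p -> nabla X Y p - nabla Y X p = lie X Y p;
  lc_metric : forall U X Y Z, open U ->
    smooth_field U X -> smooth_field U Y -> smooth_field U Z ->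
    forall p, U p -> fderiv X (fun q => gval g q (Y q) (Z q)) p
                     = gval g p (nabla X Y p) (Z p) + gval g p (Y p) (nabla X Z p)
}.

(* The field with constant components u in the chart [chart_at M p]; it is
   smooth on the domain of that chart and takes the value u at p. *)
Definition extend p u : M -> 'cV[R]_m := fun q =>
  'D_u (coord (chart_at q) \o chart_inv (chart_at p)) (coord (chart_at p) q).

Section Curvature.
Variables (g : M -> 'M[R]_m)
  (nabla : (M -> 'cV[R]_m) -> (M -> 'cV[R]_m) -> (M -> 'cV[R]_m)).

Definition curvature X Y Z : M -> 'cV[R]_m := fun p =>
  nabla X (nabla Y Z) p - nabla Y (nabla X Z) p - nabla (lie X Y) Z p.

(* The curvature is tensorial, so any extension of u, v, w to local vector
   fields gives the same value at p. *)
Definition curv p u v w : 'cV[R]_m :=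
  curvature (extend p u) (extend p v) (extend p w) p.

Definition curv4 p u v w z : R := gval g p (curv p u v w) z.

Definition orthonormal p (e : 'I_m -> 'cV[R]_m) : Prop :=
  forall i j, gval g p (e i) (e j) = (i == j)%:R.

Definition ricci p (e : 'I_m -> 'cV[R]_m) v w : R :=
  \sum_i curv4 p (e i) v w (e i).

Definition ricci_operator (Q : M -> 'M[R]_m) : Prop :=
  forall p e, orthonormal p e ->
    forall u v, gval g p (Q p *m u) v = ricci p e u v.

Definition rbreve p (e : 'I_m -> 'cV[R]_m) u v : R :=
  \sum_i \sum_j \sum_k curv4 p u (e i) (e j) (e k) * curv4 p v (e i) (e j) (e k).

Definition curv_norm2 p (e : 'I_m -> 'cV[R]_m) : R :=
  \sum_i \sum_j \sum_k \sum_l curv4 p (e i) (e j) (e k) (e l) ^+ 2.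

Definition flat : Prop := forall p u v w, curv p u v w = 0.

Definition einstein : Prop :=
  exists lambda : R, forall p e, orthonormal p e ->
    forall u v, ricci p e u v = lambda * gval g p u v.

Definition weakly_einstein : Prop :=
  forall p e, orthonormal p e ->
    forall u v, rbreve p e u v = curv_norm2 p e / m%:R * gval g p u v.

End Curvature.
End Manifold.

(* Main.v *)
From HB Require Import structures.
From mathcomp Require Import all_boot all_order all_algebra.
From mathcomp Require Import all_classical all_reals all_analysis.
From mathcomp Require Import ring lra.
Require Import Defs.

Set Implicit Arguments.
Unset Strict Implicit.
Unset Printing Implicit Defensive.

Import Order.TTheory GRing.Theory Num.Theory.
Import numFieldNormedType.Exports.

Local Open Scope classical_set_scope.
Local Open Scope ring_scope.

(** Why the theorem holds.  Write [N X] for the covariant derivative of [xi]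
    along [X].  The contact condition says that the skew part of [N] is [- phi],
    so [N xi = 0], [N] preserves the contact plane, and in a local orthonormal frame
    [xi], [e1], [phi e1] the off-diagonal entries of [N] differ by 2
    ([connection_contact]).  The first Bianchi identity makes [N] trace-free
    ([nabla_xi_trace]); classically this is the closedness of the 2-form [d eta].
    The Ricci curvature of [xi] is then minus the trace of the square of [N], so
    [Q xi = 0] forces [N] to be nilpotent on the contact plane
    ([nabla_xi_nilpotent]), and it is nowhere zero because of its skew part.

    The image of [N] is therefore a smooth line field which [N] kills.
    Normalising a vector field in it gives the vector [phi e1] of a second frame
    in which [N (phi e1) = 0] and [N e1 = - 2 phi e1] ([exists_special]).  This uses a
    normalised vector field in place of smooth eigenvectors of the symmetric part
    of [N].  In that frame [Q xi = 0], now applied to the mixed components, kills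
    two more connection coefficients, and all curvature components become
    constant multiples of a single function ([riemann_special_frame]).  In tensor
    form ([curvature_normal_form]), there are a unit vector [t] orthogonal to [xi]
    and a scalar [k] with
      R(u,v,w,z) = k (B(v,w) B(u,z) - B(u,w) B(v,z)),
      B(u,v) = g(u,v) - 2 g(u,t) g(v,t),
    at each point: [B] is [g] composed with the reflection in the plane orthogonal to [t].

    The conclusion is algebra in such a normal form.  As [B] has trace 1 and is
    the Gram form of an isometric involution, the Ricci tensor is
    -2k g(u,t) g(v,t), which has rank at most 1, and the contracted square of the
    curvature is 4k^2 g(u,v) ([ricci_reflected], [rbreve_reflected]).  If the
    metric were Einstein, evaluating on [xi] would make the Einstein constant 0,
    and evaluating on [t] would give [k = 0] everywhere, that is, flatness.

    Underneath lies the calculus which justifies computing in moving frames: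
    second derivatives commute ([derive_swap]), so the bracket acts on functions
    as a commutator ([fderiv_lie]) and satisfies the Jacobi identity ([jacobi]);
    hence the curvature is tensorial ([curv_frame]) and satisfies the first
    Bianchi identity ([curvature_bianchi]). *)

(** * Calculus on normed spaces *)

Section Calculus.
Variable R : realType.
Implicit Types V W : normedModType R.

Lemma near_eq_differentiable V W (f g : V -> W) x :
  (\near x, f x = g x) -> differentiable f x -> differentiable g x.
Proof.
move=> fg df.
have -> : g = f + (g - f) by apply/funext => y; rewrite !fctE addrC subrK.
apply: differentiableD => //; set h := g - f.
have h0 : \near x, h x = 0.
  by near=> y; rewrite /h !fctE (near fg y) ?subrr.
have h0x : \forall z \near (0 : V), h (z + x) = 0.
  by rewrite (near_shift x) /=; near=> z; rewrite /= sub0r ?subrK; near: z.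
have ho : h \o shift x = cst (h x) + cst 0 +o_ 0 id.
  apply/eqaddoP => e e0; near=> y.
  have -> : (h \o shift x - (cst (h x) + cst 0)) y = 0.
    rewrite !fctE /= (nbhs_singleton h0) addr0 subr0.
    by near: y; exact: h0x.
  by rewrite normr0 mulr_ge0 // ltW.
have d0 : 'd h x = cst 0 :> (V -> W).
  have @z : {linear V -> W} by exists (cst 0 : V -> W); exact: (GRing.Linear.class \0).
  have -> : (cst 0 : V -> W) = z by [].
  by apply: diff_unique => //; apply: cst_continuous.
by apply/diff_locallyP; rewrite d0; split => //; exact: cst_continuous.
Unshelve. all: by end_near. Qed.

Lemma open_near V (A : set V) (P : V -> Prop) x :
  open A -> A x -> (forall y, A y -> P y) -> \forall y \near x, P y.
Proof. by move=> oA Ax AP; apply: filterS (open_nbhs_nbhs (conj oA Ax)). Qed.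

Lemma Ck_ext V W k (A : set V) (f g : V -> W) : open A ->
  (forall x, A x -> f x = g x) -> Ck k A f -> Ck k A g.
Proof.
move=> oA; elim: k f g => [|k IH] f g fg /=.
  move=> cf x Ax; rewrite /prop_for /continuous_at -fg //.
  apply: cvg_trans (cf x Ax); apply: near_eq_cvg.
  by apply: open_near oA Ax _ => y /fg ->.
move=> [df dDf]; split=> [x Ax|v].
  apply: near_eq_differentiable (df x Ax).
  by apply: open_near oA Ax _ => y /fg.
apply: IH (dDf v) => x Ax; apply: near_eq_derive.
by apply: open_near oA Ax _ => y /fg.
Qed.

Lemma Ck_sub V W k (A B : set V) (f : V -> W) : B `<=` A -> Ck k A f -> Ck k B f.
Proof.
move=> BA; elim: k f => [|k IH] f /=; first by move=> cf x /BA /cf.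
by move=> [df dDf]; split=> [x /BA /df|v] //; exact: IH.
Qed.

Lemma CkS V W k (A : set V) (f : V -> W) : Ck k.+1 A f -> Ck k A f.
Proof.
elim: k f => [|k IH] f /=.
  by move=> [df _] x /df; exact: differentiable_continuous.
by move=> [df dDf]; split => // v; apply: IH; exact: dDf.
Qed.

Lemma Ck_cst V W k (A : set V) (w : W) : Ck k A (cst w).
Proof.
elim: k w => [|k IH] w /=; first by move=> x _; exact: cst_continuous.
split=> [x _|v]; first exact: differentiable_cst.
have -> : 'D_v (cst w) = cst 0 by apply/funext => x; rewrite derive_cst.
exact: IH.
Qed.

Lemma CkD V W k (A : set V) (f g : V -> W) : open A ->
  Ck k A f -> Ck k A g -> Ck k A (f + g).
Proof.
move=> oA; elim: k f g => [|k IH] f g /=.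
  by move=> cf cg x Ax; apply: continuousD; [exact: cf|exact: cg].
move=> [df dDf] [dg dDg]; split=> [x Ax|v].
  by apply: differentiableD; [exact: df|exact: dg].
apply: (@Ck_ext _ _ _ _ ('D_v f + 'D_v g)) => //; last exact: IH.
move=> x Ax; rewrite deriveD //; apply: diff_derivable; [exact: df|exact: dg].
Qed.

Lemma Ck_sum V W k (A : set V) n (f : 'I_n -> V -> W) : open A ->
  (forall i, Ck k A (f i)) -> Ck k A (\sum_i f i).
Proof.
move=> oA cf; elim/big_rec: _ => [|i g _ cg]; first exact: Ck_cst.
by apply: CkD.
Qed.

Lemma CkM V k (A : set V) (f g : V -> R) : open A ->
  Ck k A f -> Ck k A g -> Ck k A (f * g).
Proof.
move=> oA; elim: k f g => [|k IH] f g cf cg.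
  by move=> x Ax; apply: continuousM; [exact: cf|exact: cg].
have [[df dDf] [dg dDg]] := (cf, cg); split=> [x Ax|v].
  by apply: differentiableM; [exact: df|exact: dg].
apply: (@Ck_ext _ _ _ _ (f * 'D_v g + g * 'D_v f)) => //.
  move=> x Ax; rewrite deriveM //; apply: diff_derivable; [exact: df|exact: dg].
by apply: CkD => //; apply: IH; [exact: CkS|exact: dDg|exact: CkS|exact: dDf].
Qed.

Lemma CkV V k (A : set V) (f : V -> R) : open A -> (forall x, A x -> f x != 0) ->
  Ck k A f -> Ck k A (fun x => (f x)^-1).
Proof.
move=> oA f0; elim: k => [|k IH] cf.
  move=> x Ax; apply: (@continuous_comp _ _ _ f (fun y : R => y^-1)).
    exact: cf.
  by apply: inv_continuous; exact: f0.
have [df dDf] := cf; split=> [x Ax|v].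
  by apply: differentiableV; rewrite ?f0 //; exact: df.
have cV := IH (CkS cf).
apply: (@Ck_ext _ _ _ _ (cst (-1) * ((fun x => (f x)^-1) * (fun x => (f x)^-1)) * 'D_v f)) => //.
  move=> x Ax; have dv : derivable f x v by apply: diff_derivable; exact: df.
  rewrite (deriveV (f0 x Ax) dv).
  by rewrite !fctE /= expr2 invfM mulN1r.
apply: CkM (dDf v) => //; apply: CkM => //; first exact: Ck_cst.
exact: CkM.
Qed.

(** The norm of a matrix is the maximum of its entries, so regularity is entrywise;
    this reduces every closure property to scalar functions. *)
Lemma Ck_mx V k (A : set V) m n (F : V -> 'M[R]_(m, n)) : open A ->
  Ck k A F <-> forall i j, Ck k A (fun x => F x i j).
Proof.
move=> oA; split.
  elim: k F => [|k IH] F /=.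
    move=> cF i j x Ax.
    apply: (@continuous_comp _ _ _ F (fun N : 'M[R]_(m, n) => N i j : R)).
      exact: cF.
    exact/differentiable_continuous/differentiable_coord.
  move=> [dF dDF] i j; split=> [x Ax|v].
    apply: (@differentiable_comp _ _ _ _ F (fun N : 'M[R]_(m, n) => N i j)).
      exact: dF.
    exact: differentiable_coord.
  apply: Ck_ext (IH _ (dDF v) i j) => // x Ax.
  by rewrite derive_mx ?mxE //; apply: diff_derivable; exact: dF.
elim: k F => [|k IH] F /= cF.
  move=> x Ax; apply/cvgrPdist_le => /= e e0; near=> y.
  rewrite /Num.Def.normr/= mx_normrE (bigmax_le _ (ltW e0))//= => i _.
  rewrite !mxE/=.
  move: i; near: y; apply: filter_forall => /= i.
  by have /cvgrPdist_le /(_ _ e0) := cF i.1 i.2 x Ax.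
have dF x : A x -> differentiable F x.
  move=> Ax.
  have -> : F = \sum_(i < m) \sum_(j < n) (fun x => F x i j *: delta_mx i j).
    apply/funext => y; rewrite {1}[F y]matrix_sum_delta fct_sumE.
    by apply: eq_bigr => i _; rewrite fct_sumE.
  apply: differentiable_sum => i; apply: differentiable_sum => j.
  by apply: differentiableZl; case: (cF i j) => + _; apply.
split => // v; apply: IH => i j.
apply: Ck_ext ((cF i j).2 v) => // x Ax.
by rewrite derive_mx ?mxE //; apply: diff_derivable; exact: dF.
Unshelve. all: by end_near. Qed.

Lemma derive_chain (U V W : normedModType R) (f : U -> V) (g : V -> W) x v :
  differentiable f x -> differentiable g (f x) ->
  'D_v (g \o f) x = 'D_('D_v f x) g (f x).
Proof.
move=> df dg; rewrite !deriveE //; last exact: differentiable_comp.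
by rewrite diff_comp.
Qed.

Lemma derive_lin V W (f : V -> W) x (a : R) u v : differentiable f x ->
  'D_(a *: u + v) f x = a *: 'D_u f x + 'D_v f x.
Proof. by move=> df; rewrite !deriveE // linearP. Qed.

Lemma derive_basis n W (f : 'cV[R]_n -> W) x v : differentiable f x ->
  'D_v f x = \sum_i v i ord0 *: 'D_(delta_mx i ord0) f x.
Proof.
move=> df; rewrite deriveE // {1}[v]matrix_sum_delta linear_sum.
apply: eq_bigr => i _.
by rewrite big_ord_recl big_ord0 addr0 linearZ deriveE.
Qed.

(** The derivative of a square root is the derivative divided by twice the square
    root, so one degree of regularity is gained at each step of the induction. *)
Lemma Ck_sqrt V k (A : set V) (f : V -> R) : open A -> (forall x, A x -> 0 < f x) ->
  Ck k A f -> Ck k A (fun x => Num.sqrt (f x)).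
Proof.
move=> oA f0; elim: k => [|k IH] cf.
  move=> x Ax; apply: (@continuous_comp _ _ _ f (@Num.sqrt R)).
    exact: cf.
  exact: sqrt_continuous.
have [df dDf] := cf.
have ds (y : R) : 0 < y -> differentiable (@Num.sqrt R) y.
  by move=> y0; apply/derivable1_diffP; have [] := is_derive1_sqrt y0.
split=> [x Ax|v].
  apply: (@differentiable_comp _ _ _ _ f (@Num.sqrt R)); first exact: df.
  exact/ds/f0.
have cS := IH (CkS cf).
have cV : Ck k A (fun x => (Num.sqrt (f x))^-1).
  by apply: CkV => // x Ax; rewrite gt_eqF // sqrtr_gt0 f0.
apply: (@Ck_ext _ _ _ _ (cst 2^-1 * (fun x => (Num.sqrt (f x))^-1) * 'D_v f)) => //.
  move=> x Ax; rewrite (@derive_chain _ _ _ f (@Num.sqrt R)); last first.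
  - exact/ds/f0.
  - exact: df.
  rewrite deriveE; last exact/ds/f0.
  rewrite -[X in 'd _ _ X]mulr1 -[X in 'd _ _ X]/(_ *: 1) linearZ -deriveE; last exact/ds/f0.
  by rewrite derive_sqrt ?f0 // !fctE /= invfM mulrC.
by apply: CkM (dDf v) => //; apply: CkM => //; exact: Ck_cst.
Qed.

Lemma Ck_derive_along_field n k (A : set 'cV[R]_n) (f : 'cV[R]_n -> R) (X : 'cV[R]_n -> 'cV[R]_n) :
  open A -> Ck k.+1 A f -> Ck k A X -> Ck k A (fun x => 'D_(X x) f x).
Proof.
move=> oA [df dDf] cX.
apply: (@Ck_ext _ _ _ _ (\sum_i (fun x => X x i ord0) * 'D_(delta_mx i ord0) f)) => //.
  by move=> x Ax; rewrite derive_basis ?fct_sumE; [|exact: df].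
apply: Ck_sum => // i; apply: CkM (dDf _) => //.
exact: ((Ck_mx _ _ oA).1 cX).
Qed.

(** By the chain rule the derivatives of a composite are sums of products of
    composites of lower order. *)
Lemma Ck_comp V n k (A : set V) (B : set 'cV[R]_n) (phi : V -> 'cV[R]_n)
    (f : 'cV[R]_n -> R) : open A -> open B -> (forall x, A x -> B (phi x)) ->
  Ck k A phi -> Ck k B f -> Ck k A (f \o phi).
Proof.
move=> oA oB AB; elim: k f => [|k IH] f cphi cf.
  move=> x Ax; apply: (@continuous_comp _ _ _ phi f); first exact: cphi.
  exact/cf/AB.
have [[dphi dDphi] [df dDf]] := (cphi, cf); split=> [x Ax|v].
  apply: differentiable_comp; first exact: dphi.
  exact/df/AB.
apply: (@Ck_ext _ _ _ _ (\sum_i (fun x => 'D_v phi x i ord0)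
                         * ('D_(delta_mx i ord0) f \o phi))) => //.
  move=> x Ax; rewrite derive_chain; [|exact: dphi|exact/df/AB].
  by rewrite derive_basis ?fct_sumE; [|exact/df/AB].
apply: Ck_sum => // i; apply: CkM => //; last exact: IH (CkS cphi) (dDf _).
exact: ((Ck_mx _ _ oA).1 (dDphi v)).
Qed.

Lemma is_derive_line V (f : V -> R) (u a : V) (s : R) :
  differentiable f (s *: u + a) ->
  is_derive s 1 (fun t : R => f (t *: u + a)) ('D_u f (s *: u + a)).
Proof.
move=> df.
have d1 : differentiable (fun t : R => t *: u + a) s.
  by apply: (@differentiableD _ _ _ (fun t : R => t *: u) (cst a)).
have dfl : differentiable (fun t : R => f (t *: u + a)) s.
  exact: (@differentiable_comp _ _ _ _ (fun t : R => t *: u + a) f).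
apply: DeriveDef; first exact: diff_derivable.
rewrite (@derive_chain _ _ _ (fun t : R => t *: u + a) f) //.
congr ('D__ _ _); rewrite (@deriveD _ _ _ (fun t : R => t *: u) (cst a)); last 2 first.
- exact: diff_derivable.
- exact: diff_derivable.
rewrite derive_cst addr0 deriveE //.
by rewrite diff_val scale1r.
Qed.

(** Two applications of the mean value theorem.  The left-hand side is symmetric
    in [u] and [v], which is what gives the symmetry of second derivatives. *)
Lemma second_difference V (A : set V) (f : V -> R) (x u v : V) (h : R) :
  0 <= h -> (forall s t, 0 <= s <= h -> 0 <= t <= h -> A (s *: u + (t *: v + x))) ->
  Ck 2 A f ->
  exists s t, [/\ 0 <= s <= h, 0 <= t <= h &
    f (h *: u + (h *: v + x)) - f (h *: u + x) - (f (h *: v + x) - f x)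
    = 'D_v ('D_u f) (s *: u + (t *: v + x)) * h * h].
Proof.
move=> h0 Ah [df dDf].
have [dDuf _] := dDf u.
pose F s := f (s *: u + (h *: v + x)) - f (s *: u + x).
pose dF s := 'D_u f (s *: u + (h *: v + x)) - 'D_u f (s *: u + x).
have hh : 0 <= h <= h by rewrite h0 lexx.
have h00 : 0 <= (0 : R) <= h by rewrite lexx h0.
have Ax s : 0 <= s <= h -> A (s *: u + x).
  by move=> hs; have := Ah s 0 hs h00; rewrite scale0r add0r.
have FdF s : 0 <= s <= h -> is_derive s 1 F (dF s).
  move=> hs; apply: is_deriveB; apply: is_derive_line; apply: df.
    exact: Ah.
  exact: Ax.
have [s sh Fs] : exists2 s, s \in `[0, h] & F h - F 0 = dF s * (h - 0).
  apply: (MVT_segment h0).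
    by move=> s; rewrite in_itv /= => /andP[/ltW s0 /ltW s1]; apply: FdF; rewrite s0.
  apply: derivable_within_continuous => s; rewrite in_itv /= => hs.
  by have [] := FdF s hs.
move: sh; rewrite in_itv /= => sh.
pose G t := 'D_u f (t *: v + (s *: u + x)).
pose dG t := 'D_v ('D_u f) (t *: v + (s *: u + x)).
have swap t : t *: v + (s *: u + x) = s *: u + (t *: v + x) by rewrite addrCA.
have GdG t : 0 <= t <= h -> is_derive t 1 G (dG t).
  by move=> ht; apply: is_derive_line; apply: dDuf; rewrite swap; exact: Ah.
have [t th Gt] : exists2 t, t \in `[0, h] & G h - G 0 = dG t * (h - 0).
  apply: (MVT_segment h0).
    by move=> t; rewrite in_itv /= => /andP[/ltW t0 /ltW t1]; apply: GdG; rewrite t0.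
  apply: derivable_within_continuous => t; rewrite in_itv /= => ht.
  by have [] := GdG t ht.
move: th; rewrite in_itv /= => th.
exists s, t; split => //.
have -> : f (h *: u + (h *: v + x)) - f (h *: u + x) - (f (h *: v + x) - f x) = F h - F 0.
  by rewrite /F !scale0r !add0r.
rewrite Fs subr0; congr (_ * _).
have -> : dF s = G h - G 0 by rewrite /dF /G swap scale0r add0r.
by rewrite Gt subr0 /dG swap.
Qed.

(** Both iterated derivatives are limits of the same second difference quotient. *)
Lemma derive_swap V (A : set V) (f : V -> R) (x u v : V) : open A -> A x ->
  Ck 2 A f -> 'D_v ('D_u f) x = 'D_u ('D_v f) x.
Proof.
move=> oA Ax cf.
have [df dDf] := cf.
have cuv : {for x, continuous ('D_v ('D_u f))} by exact: (dDf u).2 v x Ax.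
have cvu : {for x, continuous ('D_u ('D_v f))} by exact: (dDf v).2 u x Ax.
apply/eqP; rewrite -subr_eq0 -normr_le0; apply/ler_addgt0Pl => e e0; rewrite addr0.
have e2 : 0 < e / 2 by rewrite divr_gt0.
have Ax' : nbhs x A by exact: open_nbhs_nbhs.
have : \forall y \near x, [/\ A y,
    `|'D_v ('D_u f) x - 'D_v ('D_u f) y| < e / 2 &
    `|'D_u ('D_v f) x - 'D_u ('D_v f) y| < e / 2].
  move: cuv => /cvgrPdist_lt /(_ _ e2) cuv; move: cvu => /cvgrPdist_lt /(_ _ e2) cvu.
  have cuv' : nbhs x (fun t => `|'D_v ('D_u f) x - 'D_v ('D_u f) t| < e / 2) := cuv.
  have cvu' : nbhs x (fun t => `|'D_u ('D_v f) x - 'D_u ('D_v f) t| < e / 2) := cvu.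
  apply: filterS (filterI Ax' (filterI cuv' cvu')).
  by move=> y [Ay [c1 c2]]; split.
case/nbhs_ballP => d /= d0 dP.
(* The step is small enough for all points of the second differences to lie in
   the ball; the added 1 covers the case where [u] and [v] are zero. *)
pose h := d / 2 / (`|u| + `|v| + 1).
have n0 : 0 < `|u| + `|v| + 1 by rewrite ltr_wpDl // addr_ge0.
have h0 : 0 < h by rewrite !divr_gt0.
have small s t (a b : V) : `|a| + `|b| = `|u| + `|v| -> 0 <= s <= h -> 0 <= t <= h ->
    ball x d (s *: a + (t *: b + x)).
  move=> ab /andP[s0 sh] /andP[t0 th].
  rewrite -ball_normE /= addrA opprD [- _ - x]addrC addrA subrr add0r normrN.
  apply: le_lt_trans (ler_normD _ _) _; rewrite !normrZ !ger0_norm //.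
  have : s * `|a| + t * `|b| <= h * (`|u| + `|v| + 1).
    rewrite -ab; have := normr_ge0 a; have := normr_ge0 b; nra.
  rewrite /h divfK ?gt_eqF // => /le_lt_trans; apply.
  by rewrite ltr_pdivrMr // ltr_pMr // ltr1n.
have [s [t [sh th E1]]] : exists s t, [/\ 0 <= s <= h, 0 <= t <= h &
    f (h *: u + (h *: v + x)) - f (h *: u + x) - (f (h *: v + x) - f x)
    = 'D_v ('D_u f) (s *: u + (t *: v + x)) * h * h].
  apply: (@second_difference _ A) => //; first exact: ltW.
  by move=> s t sh th; have [] := dP _ (small s t u v erefl sh th).
have [s' [t' [sh' th' E2]]] : exists s t, [/\ 0 <= s <= h, 0 <= t <= h &
    f (h *: v + (h *: u + x)) - f (h *: v + x) - (f (h *: u + x) - f x)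
    = 'D_u ('D_v f) (s *: v + (t *: u + x)) * h * h].
  apply: (@second_difference _ A) => //; first exact: ltW.
  by move=> s' t' sh' th'; have [] := dP _ (small s' t' v u (addrC _ _) sh' th').
have E : 'D_v ('D_u f) (s *: u + (t *: v + x)) = 'D_u ('D_v f) (s' *: v + (t' *: u + x)).
  have hn0 : h != 0 by rewrite gt_eqF.
  move: E1 E2; rewrite [h *: v + (h *: u + x)]addrCA.
  have aux (a b c e' k l : R) : a - b - (c - e') = k * h * h ->
      a - c - (b - e') = l * h * h -> k = l.
    by move=> k1 l1; apply: (mulIf hn0); apply: (mulIf hn0); rewrite -k1 -l1; ring.
  exact: aux.
have [_ c1 _] := dP _ (small s t u v erefl sh th).
have [_ _ c2] := dP _ (small s' t' v u (addrC _ _) sh' th').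
rewrite {}E in c1; move: c1 c2.
have aux (a b c : R) : `|a - c| < e / 2 -> `|b - c| < e / 2 -> `|a - b| <= e.
  move=> ac bc; have -> : a - b = (a - c) - (b - c) by ring.
  by apply: le_trans (ler_normB _ _) _; rewrite [leRHS]splitr; apply: lerD; exact: ltW.
exact: aux.
Qed.

End Calculus.

(** The product rule for a derivative along a varying direction: the direction is
    differentiated in the first term and frozen in the second. *)
Lemma derive_along_field (R : realType) n (A : set 'cV[R]_n) (f : 'cV[R]_n -> R)
    (Y : 'cV[R]_n -> 'cV[R]_n) x u : open A -> A x -> Ck 2 A f ->
  differentiable Y x ->
  'D_u (fun z => 'D_(Y z) f z) x
  = 'D_('D_u Y x) f x + 'D_u ('D_(Y x) f) x.
Proof.
move=> oA Ax cf dY; have [df dDf] := cf.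
have dDf' v : differentiable ('D_v f) x by have [+ _] := dDf v; apply.
have dYi i : differentiable (fun z => Y z i ord0) x.
  apply: (@differentiable_comp _ _ _ _ Y (fun N : 'cV[R]_n => N i ord0 : R)) => //.
  exact: differentiable_coord.
transitivity ('D_u (\sum_i (fun z => Y z i ord0) * 'D_(delta_mx i ord0) f) x).
  apply: near_eq_derive; apply: (open_near oA Ax) => y Ay.
  by rewrite derive_basis ?fct_sumE; [|exact: df].
rewrite derive_sum; last first.
  by move=> i; apply: derivableM; apply: diff_derivable.
rewrite (derive_swap _ _ oA Ax cf) (derive_basis ('D_u Y x) (df x Ax)).
rewrite (derive_basis (Y x) (dDf' u)) -big_split /=.
apply: eq_bigr => i _.
rewrite deriveM; [|exact: diff_derivable|exact: diff_derivable].
rewrite addrC (derive_swap _ _ oA Ax cf); congr (_ + _).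
rewrite derive_mx; last exact: diff_derivable.
by rewrite mxE [LHS]mulrC.
Qed.

(** * Functions, vector fields and brackets on a manifold *)

Section Charts.
Variables (R : realType) (m : nat) (M : manifold R m).
Implicit Types (p q : M) (u v w z : 'cV[R]_m) (U : set M).
Implicit Types (X Y Z : M -> 'cV[R]_m) (c d : chart R M m) (f h : M -> R).

Lemma chart_near c q (P : M -> Prop) : chart_dom c q ->
  (\forall r \near q, P r) -> \forall x \near coord c q, P (chart_inv c x).
Proof.
move=> cq Pq.
have im : (coord c @` chart_dom c) (coord c q) by exists q.
by have := chart_inv_continuous im; rewrite /prop_for /continuous_at coordK //; apply.
Qed.

Lemma coord_image_open U c : open U -> open (coord c @` (U `&` chart_dom c)).
Proof.
move=> oU; rewrite openE => _ [q [Uq cq] <-].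
have H1 : \forall x \near coord c q, U (chart_inv c x).
  by apply: chart_near => //; exact: open_nbhs_nbhs.
have H2 : \forall x \near coord c q, (coord c @` chart_dom c) x.
  by apply: open_nbhs_nbhs; split; [exact: chart_image_open|exists q].
rewrite /interior; near=> x.
have [r cr rx] : (coord c @` chart_dom c) x by near: x.
exists r => //; split => //.
have : U (chart_inv c x) by near: x.
by rewrite -rx coordK.
Unshelve. all: by end_near. Qed.

Arguments coord_image_open [U] c _.

Lemma coordK_near c q : chart_dom c q ->
  \forall x \near coord c q, coord c (chart_inv c x) = x.
Proof.
move=> cq.
have : \forall x \near coord c q, (coord c @` chart_dom c) x.
  by apply: open_nbhs_nbhs; split; [exact: chart_image_open|exists q].
by apply: filterS => _ [r cr <-]; rewrite coordK.
Qed.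

Lemma dom_near c q : chart_dom c q -> \forall r \near q, chart_dom c r.
Proof. by move=> cq; apply: open_nbhs_nbhs; split => //; exact: chart_dom_open. Qed.

Lemma differentiable_transition c d q : atlas c -> atlas d ->
  chart_dom c q -> chart_dom d q ->
  differentiable (coord d \o chart_inv c) (coord c q).
Proof.
move=> ac ad cq dq; have [+ _] := @atlas_compatible _ _ M c d ac ad 1%N.
by apply; exists q.
Qed.

(** Tangent vectors are written in a chart that changes with the point, and
    discontinuously so.  The chain rule lets one compute near a point in one fixed
    chart. *)
Lemma tderiv_chart (W : normedModType R) d q (f : M -> W) v : atlas d ->
  chart_dom d q -> differentiable (f \o chart_inv d) (coord d q) ->
  tderiv q v f = 'D_(components d q v) (f \o chart_inv d) (coord d q).
Proof.
move=> ad dq df; rewrite /tderiv /components.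
set c := chart_at q; have ac : atlas c := chart_at_atlas q.
have cq : chart_dom c q := chart_at_dom q.
have -> : 'D_v (f \o chart_inv c) (coord c q)
  = 'D_v ((f \o chart_inv d) \o (coord d \o chart_inv c)) (coord c q).
  apply: near_eq_derive; have := chart_near cq (dom_near dq).
  by apply: filterS => x dx /=; rewrite coordK.
rewrite derive_chain /=; [|exact: differentiable_transition|by rewrite coordK].
by rewrite /tderiv -/c coordK.
Qed.

Lemma components_lin c q (a : R) u v : atlas c -> chart_dom c q ->
  components c q (a *: u + v) = a *: components c q u + components c q v.
Proof.
move=> ac cq; rewrite /components /tderiv derive_lin //.
by apply: differentiable_transition => //; [exact: chart_at_atlas|exact: chart_at_dom].
Qed.

Lemma components_at p v : components (chart_at p) p v = v.
Proof.
rewrite /components /tderiv -[RHS](derive_id (coord (chart_at p) p)).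
apply: near_eq_derive; apply: filterS (coordK_near (chart_at_dom p)).
by move=> x /= ->.
Qed.

Lemma smooth_fun_differentiable (W : normedModType R) U (f : M -> W) c q : smooth_fun U f ->
  U q -> atlas c -> chart_dom c q -> differentiable (f \o chart_inv c) (coord c q).
Proof. by move=> sf Uq ac cq; have [+ _] := sf c ac 1%N; apply; exists q. Qed.

Lemma smooth_fun_ext U f h : open U -> (forall q, U q -> f q = h q) ->
  smooth_fun U f -> smooth_fun U h.
Proof.
move=> oU fh sf c ac k; apply: Ck_ext (sf c ac k); first exact: coord_image_open.
by move=> _ [q [Uq cq] <-] /=; rewrite (coordK cq) (fh q Uq).
Qed.

Lemma smooth_fun_sub U V f : V `<=` U -> smooth_fun U f -> smooth_fun V f.
Proof.
move=> VU sf c ac k; apply: Ck_sub (sf c ac k).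
by move=> _ [q [Vq cq] <-]; exists q => //; split => //; exact: VU.
Qed.

Lemma smooth_fun_cst U (a : R) : smooth_fun U (cst a : M -> R).
Proof. by move=> c ac k; exact: Ck_cst. Qed.

Lemma smooth_funD U f h : open U -> smooth_fun U f -> smooth_fun U h ->
  smooth_fun U (fun q => f q + h q).
Proof.
by move=> oU sf sh c ac k; apply: CkD (sf c ac k) (sh c ac k); exact: coord_image_open.
Qed.

Lemma smooth_funM U f h : open U -> smooth_fun U f -> smooth_fun U h ->
  smooth_fun U (fun q => f q * h q).
Proof.
by move=> oU sf sh c ac k; apply: CkM (sf c ac k) (sh c ac k); exact: coord_image_open.
Qed.

Lemma smooth_funN U f : open U -> smooth_fun U f -> smooth_fun U (fun q => - f q).
Proof.
move=> oU sf; apply: smooth_fun_ext (smooth_funM oU (smooth_fun_cst U (-1)) sf) => //.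
by move=> q Uq; rewrite mulN1r.
Qed.

(** The function by which a vector field of square norm [f] is multiplied to obtain
    a unit field. *)
Lemma smooth_fun_normalizer U f : open U -> (forall q, U q -> 0 < f q) ->
  smooth_fun U f -> smooth_fun U (fun q => (Num.sqrt (f q))^-1).
Proof.
move=> oU f0 sf c ac k; have oA := coord_image_open c oU.
apply: CkV => //.
  by move=> _ [q [Uq cq] <-] /=; rewrite coordK // gt_eqF // sqrtr_gt0 f0.
apply: Ck_sqrt (sf c ac k) => //.
by move=> _ [q [Uq cq] <-] /=; rewrite coordK // f0.
Qed.

Lemma smooth_field_ext U X Y : open U -> (forall q, U q -> X q = Y q) ->
  smooth_field U X -> smooth_field U Y.
Proof.
move=> oU fh sf c ac k; apply: Ck_ext (sf c ac k); first exact: coord_image_open.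
by move=> _ [q [Uq cq] <-] /=; rewrite (coordK cq) (fh q Uq).
Qed.

Lemma smooth_field_sub U V X : V `<=` U -> smooth_field U X -> smooth_field V X.
Proof.
move=> VU sf c ac k; apply: Ck_sub (sf c ac k).
by move=> _ [q [Vq cq] <-]; exists q => //; split => //; exact: VU.
Qed.

Lemma smooth_fieldZD U f X Y : open U -> smooth_fun U f -> smooth_field U X ->
  smooth_field U Y -> smooth_field U (fun q => f q *: X q + Y q).
Proof.
move=> oU sf sX sY c ac k; have oA := coord_image_open c oU.
set X' := fun x => components c (chart_inv c x) (X (chart_inv c x)).
set Y' := fun x => components c (chart_inv c x) (Y (chart_inv c x)).
apply: (@Ck_ext _ _ _ _ _ ((fun x => f (chart_inv c x) *: X' x) + Y')) => //.
  by move=> _ [q [Uq cq] <-] /=; rewrite !fctE /X' /Y' coordK // components_lin.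
apply: CkD (sY c ac k) => //; apply/(Ck_mx _ _ oA) => i j.
apply: (@Ck_ext _ _ _ _ _ ((f \o chart_inv c) * (fun x => X' x i j))) => //.
  by move=> x _; rewrite !fctE /= mxE.
by apply: CkM (sf c ac k) ((Ck_mx k _ oA).1 (sX c ac k) i j).
Qed.

Lemma smooth_field0 U : smooth_field U (fun _ => 0).
Proof.
move=> c ac k.
have z q : components c q 0 = 0 by rewrite /components /tderiv derive0.
have -> : (fun x => components c (chart_inv c x) 0) = cst 0.
  by apply/funext => x; rewrite z.
exact: Ck_cst.
Qed.

Lemma smooth_fieldZ U f X : open U -> smooth_fun U f -> smooth_field U X ->
  smooth_field U (fun q => f q *: X q).
Proof.
move=> oU sf sX; apply: smooth_field_ext (smooth_fieldZD oU sf sX (smooth_field0 U)) => //.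
by move=> q _; rewrite addr0.
Qed.

Lemma smooth_fieldD U X Y : open U -> smooth_field U X -> smooth_field U Y ->
  smooth_field U (fun q => X q + Y q).
Proof.
move=> oU sX sY; apply: smooth_field_ext (smooth_fieldZD oU (smooth_fun_cst U 1) sX sY) => //.
by move=> q _; rewrite scale1r.
Qed.

Lemma smooth_fieldN U X : open U -> smooth_field U X ->
  smooth_field U (fun q => - X q).
Proof.
move=> oU sX; apply: smooth_field_ext (smooth_fieldZ oU (smooth_fun_cst U (-1)) sX) => //.
by move=> q _; rewrite scaleN1r.
Qed.

Lemma smooth_fieldB U X Y : open U -> smooth_field U X -> smooth_field U Y ->
  smooth_field U (fun q => X q - Y q).
Proof. by move=> oU sX sY; exact: (smooth_fieldD oU sX (smooth_fieldN oU sY)). Qed.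

Lemma smooth_field_sum U n (F : 'I_n -> M -> 'cV[R]_m) : open U ->
  (forall i, smooth_field U (F i)) -> smooth_field U (fun q => \sum_i F i q).
Proof.
move=> oU sF; elim: n F sF => [|n IH] F sF.
  by apply: smooth_field_ext (smooth_field0 U) => // q _; rewrite big_ord0.
apply: (@smooth_field_ext _ (fun q => F ord0 q + \sum_i F (lift ord0 i) q)) => //.
  by move=> q _; rewrite big_ord_recl.
by apply: smooth_fieldD => //; exact: IH.
Qed.

Lemma tderiv_ext p v f h : (\forall q \near p, f q = h q) -> tderiv p v f = tderiv p v h.
Proof.
move=> fh; apply: near_eq_derive.
exact: chart_near (chart_at_dom p) fh.
Qed.

Lemma fderiv_ext U X X' f h p : open U -> U p -> X p = X' p ->
  (forall q, U q -> f q = h q) -> fderiv X f p = fderiv X' h p.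
Proof.
move=> oU Up XX fh; rewrite /fderiv XX; apply: tderiv_ext.
by apply: filterS (open_nbhs_nbhs (conj oU Up)) => q /fh.
Qed.

Section Derivation.
Variables (U : set M) (p : M) (f h : M -> R).
Hypotheses (Up : U p) (sf : smooth_fun U f) (sh : smooth_fun U h).

Let df : differentiable (f \o chart_inv (chart_at p)) (coord (chart_at p) p).
Proof. exact: smooth_fun_differentiable sf Up (chart_at_atlas p) (chart_at_dom p). Qed.

Let dh : differentiable (h \o chart_inv (chart_at p)) (coord (chart_at p) p).
Proof. exact: smooth_fun_differentiable sh Up (chart_at_atlas p) (chart_at_dom p). Qed.

Lemma fderiv_cst X (a : R) : fderiv X (cst a : M -> R) p = 0.
Proof.
rewrite /fderiv /tderiv.
by have -> : (cst a : M -> R) \o chart_inv (chart_at p) = cst a by []; rewrite derive_cst.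
Qed.

Lemma fderivD X : fderiv X (fun q => f q + h q) p = fderiv X f p + fderiv X h p.
Proof.
rewrite /fderiv /tderiv -deriveD //; exact: diff_derivable.
Qed.

Lemma fderivM X : fderiv X (fun q => f q * h q) p
  = fderiv X f p * h p + f p * fderiv X h p.
Proof.
rewrite /fderiv /tderiv [X in _ = X]addrC.
have -> : (fun q => f q * h q) \o chart_inv (chart_at p) =
  (f \o chart_inv (chart_at p)) * (h \o chart_inv (chart_at p)) by [].
rewrite deriveM; [|exact: diff_derivable|exact: diff_derivable].
rewrite /= coordK; last exact: chart_at_dom.
by congr (_ + _); exact: mulrC.
Qed.

End Derivation.

Lemma fderiv_chart U X f d x : open U -> smooth_fun U f -> atlas d ->
  (coord d @` (U `&` chart_dom d)) x ->
  fderiv X f (chart_inv d x)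
  = 'D_(components d (chart_inv d x) (X (chart_inv d x))) (f \o chart_inv d) x.
Proof.
move=> oU sf ad [q [Uq dq] <-]; rewrite coordK //.
by rewrite /fderiv (tderiv_chart _ ad dq) //; exact: smooth_fun_differentiable sf Uq ad dq.
Qed.

Lemma smooth_fderiv U X f : open U -> smooth_field U X -> smooth_fun U f ->
  smooth_fun U (fderiv X f).
Proof.
move=> oU sX sf c ac k; have oA := coord_image_open c oU.
apply: Ck_ext (Ck_derive_along_field oA (sf c ac k.+1) (sX c ac k)) => // x Ax.
by rewrite /= (fderiv_chart X oU sf ac Ax).
Qed.

(** In the chart at [p] an iterated derivative splits into a part containing the
    derivative of the components of [Y], which makes up the bracket, and a second
    derivative in frozen directions. *)
Lemma fderiv_fderiv U X Y f p : open U -> U p -> smooth_field U Y -> smooth_fun U f ->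
  fderiv X (fderiv Y f) p =
  'D_(tderiv p (X p) (fun q => components (chart_at p) q (Y q)))
     (f \o chart_inv (chart_at p)) (coord (chart_at p) p)
  + 'D_(X p) ('D_(Y p) (f \o chart_inv (chart_at p))) (coord (chart_at p) p).
Proof.
move=> oU Up sY sf; set d := chart_at p.
have ad : atlas d := chart_at_atlas p; have dp : chart_dom d p := chart_at_dom p.
have oA := coord_image_open d oU.
have Ax : (coord d @` (U `&` chart_dom d)) (coord d p) by exists p.
set Y' := fun x => components d (chart_inv d x) (Y (chart_inv d x)).
have Yp : Y p = Y' (coord d p) by rewrite /Y' coordK // components_at.
transitivity ('D_(X p) (fun x => 'D_(Y' x) (f \o chart_inv d) x) (coord d p)).
  rewrite {1}/fderiv /tderiv; apply: near_eq_derive.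
  by apply: (open_near oA Ax) => x Ax' /=; rewrite (fderiv_chart Y oU sf ad Ax').
rewrite (derive_along_field _ oA Ax (sf d ad 2%N)) -?Yp //.
by have [+ _] := sY d ad 1%N; apply.
Qed.

(** The second-derivative parts of the two iterated derivatives cancel because
    second derivatives commute. *)
Lemma fderiv_lie U X Y f p : open U -> U p -> smooth_field U X ->
  smooth_field U Y -> smooth_fun U f ->
  fderiv (lie X Y) f p = fderiv X (fderiv Y f) p - fderiv Y (fderiv X f) p.
Proof.
move=> oU Up sX sY sf.
rewrite (fderiv_fderiv _ oU Up sY sf) (fderiv_fderiv _ oU Up sX sf).
set d := chart_at p.
have ad : atlas d := chart_at_atlas p; have dp : chart_dom d p := chart_at_dom p.
have oA := coord_image_open d oU.
have Ax : (coord d @` (U `&` chart_dom d)) (coord d p) by exists p.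
have df := smooth_fun_differentiable sf Up ad dp.
rewrite (derive_swap _ _ oA Ax (sf d ad 2%N)) /fderiv /lie {1}/tderiv -/d.
set a := tderiv _ _ _; set b := tderiv _ _ _.
have -> : a - b = (-1) *: b + a by rewrite scaleN1r addrC.
rewrite (derive_lin _ _ _ df) scaleN1r.
have aux (r1 r2 r3 : R) : - r1 + r2 = r2 + r3 - (r1 + r3) by ring.
exact: aux.
Qed.

Lemma smooth_coord c i : atlas c -> smooth_fun (chart_dom c) (fun q => coord c q i ord0).
Proof.
move=> ac d ad k.
have oA := coord_image_open d (@chart_dom_open _ _ _ c).
apply: (Ck_mx _ _ oA).1; rewrite setIC; exact: atlas_compatible.
Qed.

(** Coordinate functions separate tangent vectors; they are smooth only on the domain
    of their chart, hence the smaller open set. *)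
Lemma tangent_ext U p u v : open U -> U p ->
  (forall V f, open V -> V p -> V `<=` U -> smooth_fun V f -> tderiv p u f = tderiv p v f) ->
  u = v.
Proof.
move=> oU Up H; rewrite -[u](components_at p) -[v](components_at p).
set d := chart_at p.
have ad : atlas d := chart_at_atlas p; have dp : chart_dom d p := chart_at_dom p.
apply/matrixP => i j; rewrite ord1 /components /tderiv -/d.
have dd : differentiable (coord d \o chart_inv d) (coord d p).
  exact: differentiable_transition.
rewrite !derive_mx; [|exact: diff_derivable|exact: diff_derivable].
rewrite !mxE; apply: (H (U `&` chart_dom d) (fun q => coord d q i ord0)).
- by apply: openI => //; exact: chart_dom_open.
- by [].
- by move=> q [].
- apply: smooth_fun_sub (smooth_coord i ad); by move=> q [].
Qed.

Lemma extend_at p u : extend p u p = u.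
Proof. exact: components_at. Qed.

(** The coordinate fields have constant components in the chart at [p]; in another
    chart their components are partial derivatives of the transition map, which is
    the reason why these fields are smooth. *)
Lemma components_extend c p q u : atlas c -> chart_dom c q -> chart_dom (chart_at p) q ->
  components c q (extend p u q)
  = 'D_u (coord c \o chart_inv (chart_at p)) (coord (chart_at p) q).
Proof.
move=> ac cq pq; set d := chart_at p in pq *.
have ad : atlas d := chart_at_atlas p; set e := chart_at q.
have ae : atlas e := chart_at_atlas q; have eq : chart_dom e q := chart_at_dom q.
rewrite /components /tderiv -/e /extend -/d -/e.
have -> : 'D_u (coord c \o chart_inv d) (coord d q) =
  'D_u ((coord c \o chart_inv e) \o (coord e \o chart_inv d)) (coord d q).
  apply: near_eq_derive; have := chart_near pq (dom_near eq).
  by apply: filterS => x dx /=; rewrite coordK.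
rewrite derive_chain /= ?coordK //; exact: differentiable_transition.
Qed.

Lemma smooth_extend p u : smooth_field (chart_dom (chart_at p)) (extend p u).
Proof.
move=> c ac k; set d := chart_at p.
have ad : atlas d := chart_at_atlas p.
have oA := coord_image_open c (@chart_dom_open _ _ _ d).
have oB := coord_image_open d (@chart_dom_open _ _ _ c).
apply: (@Ck_ext _ _ _ _ _ (('D_u (coord c \o chart_inv d)) \o (coord d \o chart_inv c))) => //.
  by move=> _ [q [dq cq] <-] /=; rewrite coordK // components_extend.
apply/(Ck_mx _ _ oA) => i j.
apply: (@Ck_comp _ _ _ _ _ (coord d @` (chart_dom c `&` chart_dom d))
  (coord d \o chart_inv c) (fun x => 'D_u (coord c \o chart_inv d) x i j)) => //.
- by move=> _ [q [dq cq] <-] /=; exists q; rewrite ?coordK.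
- by rewrite setIC; exact: atlas_compatible.
- apply: (Ck_mx _ _ oB).1; rewrite setIC.
  by have [_ +] := @atlas_compatible _ _ M d c ad ac k.+1; apply.
Qed.

End Charts.

(** * Inner product and orthonormal bases at a point *)

Section Metric.
Variables (R : realType) (m : nat) (M : manifold R m) (g : M -> 'M[R]_m).
Implicit Types (p : M) (u v w : 'cV[R]_m).

Lemma gval_linl p (a : R) u v w : gval g p (a *: u + v) w = a * gval g p u w + gval g p v w.
Proof. by rewrite /gval linearP /= !mulmxDl -!scalemxAl !mxE. Qed.

Lemma gval_linr p (a : R) u v w : gval g p w (a *: u + v) = a * gval g p w u + gval g p w v.
Proof. by rewrite /gval mulmxDr -scalemxAr !mxE. Qed.

Lemma gval0l p w : gval g p 0 w = 0.
Proof. by rewrite /gval trmx0 !mul0mx mxE. Qed.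

Lemma gval0r p w : gval g p w 0 = 0.
Proof. by rewrite /gval mulmx0 mxE. Qed.

Lemma gvalDl p u v w : gval g p (u + v) w = gval g p u w + gval g p v w.
Proof. by rewrite -[u]scale1r gval_linl mul1r scale1r. Qed.

Lemma gvalDr p u v w : gval g p w (u + v) = gval g p w u + gval g p w v.
Proof. by rewrite -[u]scale1r gval_linr mul1r scale1r. Qed.

Lemma gvalZl p a u w : gval g p (a *: u) w = a * gval g p u w.
Proof. by rewrite -[a *: u]addr0 gval_linl gval0l addr0. Qed.

Lemma gvalZr p a u w : gval g p w (a *: u) = a * gval g p w u.
Proof. by rewrite -[a *: u]addr0 gval_linr gval0r addr0. Qed.

Lemma gvalNl p u w : gval g p (- u) w = - gval g p u w.
Proof. by rewrite -scaleN1r gvalZl mulN1r. Qed.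

Lemma gvalNr p u w : gval g p w (- u) = - gval g p w u.
Proof. by rewrite -scaleN1r gvalZr mulN1r. Qed.

Lemma gval_suml p n (F : 'I_n -> 'cV[R]_m) w :
  gval g p (\sum_i F i) w = \sum_i gval g p (F i) w.
Proof.
elim: n F => [|n IH] F; first by rewrite !big_ord0 gval0l.
by rewrite !big_ord_recl gvalDl IH.
Qed.

Lemma gval_sumr p n (F : 'I_n -> 'cV[R]_m) w :
  gval g p w (\sum_i F i) = \sum_i gval g p w (F i).
Proof.
elim: n F => [|n IH] F; first by rewrite !big_ord0 gval0r.
by rewrite !big_ord_recl gvalDr IH.
Qed.

Hypothesis hg : riemannian_metric g.

Lemma gval_inj p u v : (forall w, gval g p u w = gval g p v w) -> u = v.
Proof.
move=> uv; apply/eqP; rewrite -subr_eq0; apply/negPn/negP => d0.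
by have := metric_pos hg p d0; rewrite gvalDl gvalNl uv subrr ltxx.
Qed.

(** The matrix [P] with columns [e] satisfies [P^T g P = 1]; being square, it also
    satisfies [P P^T g = 1], which is the expansion. *)
Lemma orthonormal_expand p (e : 'I_m -> 'cV[R]_m) u : orthonormal g p e ->
  u = \sum_i gval g p u (e i) *: e i.
Proof.
move=> oe; pose P : 'M[R]_m := \matrix_(i, j) e j i ord0.
have Pcol j : col j P = e j.
  by apply/matrixP => i k; rewrite (ord1 k) mxE [LHS]mxE.
have PE (w : 'cV[R]_m) : P *m w = \sum_i w i ord0 *: e i.
  apply/matrixP => i j; rewrite !mxE summxE ord1; apply: eq_bigr => k _.
  by rewrite !mxE mulrC.
have gE w i : (P^T *m g p *m w) i ord0 = gval g p (e i) w.
  by rewrite /gval -Pcol tr_col -!row_mul [RHS]mxE.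
have PP : P^T *m g p *m P = 1%:M.
  apply/matrixP => i j; rewrite !mxE -(oe i j) -gE mxE.
  by apply: eq_bigr => k _; rewrite [P k j]mxE.
have uE : u = P *m (P^T *m g p *m u) by rewrite mulmxA (mulmx1C PP) mul1mx.
rewrite {1}uE PE; apply: eq_bigr => i _.
by rewrite gE (metric_sym hg).
Qed.

Lemma parseval p (e : 'I_m -> 'cV[R]_m) u v : orthonormal g p e ->
  gval g p u v = \sum_i gval g p u (e i) * gval g p v (e i).
Proof.
move=> oe; rewrite {1}(orthonormal_expand u oe) gval_suml.
by apply: eq_bigr => i _; rewrite gvalZl (metric_sym hg p (e i) v).
Qed.

End Metric.

(** * Locality and linearity of the connection *)

Section Connection.
Variables (R : realType) (m : nat) (M : manifold R m) (g : M -> 'M[R]_m).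
Variable nabla : (M -> 'cV[R]_m) -> (M -> 'cV[R]_m) -> (M -> 'cV[R]_m).
Hypothesis hn : levi_civita g nabla.
Variables (U : set M) (oU : open U).
Implicit Types (p : M) (X Y Z : M -> 'cV[R]_m) (f h : M -> R).

(** Locality: fields that agree on [U] differ by [f] times a field, where [f] is the
    indicator of the complement of [U]; on [U] the function [f] is smooth and zero,
    so the linearity and Leibniz axioms apply. *)
Lemma nabla_ext X X' Y Y' p : smooth_field U X -> smooth_field U Y ->
  (forall q, U q -> X q = X' q) -> (forall q, U q -> Y q = Y' q) -> U p ->
  nabla X Y p = nabla X' Y' p.
Proof.
move=> sX sY XX YY Up.
pose f q : R := if `[< U q >] then 0 else 1.
have fU q : U q -> f q = 0 by rewrite /f => /asboolT ->.
have sf : smooth_fun U f.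
  by apply: (smooth_fun_ext oU) (smooth_fun_cst U 0) => q /fU.
have glue (Z Z' : M -> 'cV[R]_m) : (forall q, U q -> Z q = Z' q) ->
    Z' = (fun q => f q *: (Z' q - Z q) + Z q) /\ smooth_field U (fun q => Z' q - Z q).
  move=> ZZ; split.
    apply/funext => q; rewrite /f; case: asboolP => [Uq|_].
      by rewrite scale0r add0r ZZ.
    by rewrite scale1r subrK.
  by apply: (smooth_field_ext oU) (smooth_field0 U) => q Uq; rewrite ZZ // subrr.
have [EX sDX] := glue X X' XX; have [EY sDY] := glue Y Y' YY.
have sX' : smooth_field U X' by exact: (smooth_field_ext oU) sX.
rewrite EY (lc_leibniz hn oU sf sX' sDY sY Up) (YY p Up) (fU p Up).
rewrite subrr scaler0 scale0r !add0r.
by rewrite EX (lc_linear hn oU sf sDX sX sY Up) (fU p Up) scale0r add0r.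
Qed.

Lemma nablaDl X X' Y p : smooth_field U X -> smooth_field U X' -> smooth_field U Y ->
  U p -> nabla (fun q => X q + X' q) Y p = nabla X Y p + nabla X' Y p.
Proof.
move=> sX sX' sY Up.
have -> : (fun q => X q + X' q) = (fun q => cst (1 : R) q *: X q + X' q).
  by apply/funext => q; rewrite scale1r.
by rewrite (lc_linear hn oU (smooth_fun_cst U 1)) //= scale1r.
Qed.

Lemma nabla0l Y p : smooth_field U Y -> U p -> nabla (fun _ => 0) Y p = 0.
Proof.
move=> sY Up; have s0 := @smooth_field0 R m M U.
have := nablaDl s0 s0 sY Up.
have -> : (fun _ : M => 0 + 0 : 'cV[R]_m) = (fun _ => 0) by rewrite addr0.
by move/eqP; rewrite -subr_eq subrr => /eqP.
Qed.

Lemma nablaZl f X Y p : smooth_fun U f -> smooth_field U X -> smooth_field U Y ->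
  U p -> nabla (fun q => f q *: X q) Y p = f p *: nabla X Y p.
Proof.
move=> sf sX sY Up; have s0 := @smooth_field0 R m M U.
have -> : (fun q => f q *: X q) = (fun q => f q *: X q + 0).
  by apply/funext => q; rewrite addr0.
by rewrite (lc_linear hn oU sf sX s0 sY Up) nabla0l // addr0.
Qed.

Lemma nablaNl X Y p : smooth_field U X -> smooth_field U Y -> U p ->
  nabla (fun q => - X q) Y p = - nabla X Y p.
Proof.
move=> sX sY Up.
have -> : (fun q => - X q) = (fun q => cst (-1 : R) q *: X q).
  by apply/funext => q; rewrite scaleN1r.
by rewrite (nablaZl (smooth_fun_cst U (-1))) //= scaleN1r.
Qed.

Lemma nabla_suml n (a : 'I_n -> M -> R) (F : 'I_n -> M -> 'cV[R]_m) Y p :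
  (forall i, smooth_fun U (a i)) -> (forall i, smooth_field U (F i)) ->
  smooth_field U Y -> U p ->
  nabla (fun q => \sum_i a i q *: F i q) Y p = \sum_i a i p *: nabla (F i) Y p.
Proof.
move=> sa sF sY Up; elim: n a F sa sF => [|n IH] a F sa sF.
  have -> : (fun q => \sum_i a i q *: F i q) = (fun _ => 0).
    by apply/funext => q; rewrite big_ord0.
  by rewrite big_ord0 (nabla0l sY Up).
have -> : (fun q => \sum_i a i q *: F i q) =
  (fun q => a ord0 q *: F ord0 q + (fun r => \sum_i a (lift ord0 i) r *: F (lift ord0 i) r) q).
  by apply/funext => q; rewrite big_ord_recl.
rewrite (lc_linear hn oU (sa _) (sF _) _ sY Up).
  by rewrite big_ord_recl (IH _ _ (fun i => sa (lift ord0 i)) (fun i => sF (lift ord0 i))).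
apply: (@smooth_field_sum R m M U n (fun i q => a (lift ord0 i) q *: F (lift ord0 i) q) oU) => i.
exact: (smooth_fieldZ oU (sa _) (sF _)).
Qed.

Lemma nablaDr X Y Y' p : smooth_field U X -> smooth_field U Y -> smooth_field U Y' ->
  U p -> nabla X (fun q => Y q + Y' q) p = nabla X Y p + nabla X Y' p.
Proof.
move=> sX sY sY' Up.
have -> : (fun q => Y q + Y' q) = (fun q => cst (1 : R) q *: Y q + Y' q).
  by apply/funext => q; rewrite scale1r.
by rewrite (lc_leibniz hn oU (smooth_fun_cst U 1)) //= scale1r fderiv_cst scale0r add0r.
Qed.

Lemma nabla0r X p : smooth_field U X -> U p -> nabla X (fun _ => 0) p = 0.
Proof.
move=> sX Up; have s0 := @smooth_field0 R m M U.
have := nablaDr sX s0 s0 Up.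
have -> : (fun _ : M => 0 + 0 : 'cV[R]_m) = (fun _ => 0) by rewrite addr0.
by move/eqP; rewrite -subr_eq subrr => /eqP.
Qed.

Lemma nablaZr f X Y p : smooth_fun U f -> smooth_field U X -> smooth_field U Y ->
  U p -> nabla X (fun q => f q *: Y q) p = fderiv X f p *: Y p + f p *: nabla X Y p.
Proof.
move=> sf sX sY Up; have s0 := @smooth_field0 R m M U.
have -> : (fun q => f q *: Y q) = (fun q => f q *: Y q + 0).
  by apply/funext => q; rewrite addr0.
by rewrite (lc_leibniz hn oU sf sX sY s0 Up) nabla0r // addr0.
Qed.

Lemma nablaNr X Y p : smooth_field U X -> smooth_field U Y -> U p ->
  nabla X (fun q => - Y q) p = - nabla X Y p.
Proof.
move=> sX sY Up.
have -> : (fun q => - Y q) = (fun q => cst (-1 : R) q *: Y q).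
  by apply/funext => q; rewrite scaleN1r.
by rewrite (nablaZr (smooth_fun_cst U (-1))) //= fderiv_cst scale0r add0r scaleN1r.
Qed.

Lemma smooth_nabla X Y : smooth_field U X -> smooth_field U Y -> smooth_field U (nabla X Y).
Proof. exact: (lc_smooth hn oU). Qed.

Lemma lie_nabla X Y p : smooth_field U X -> smooth_field U Y -> U p ->
  lie X Y p = nabla X Y p - nabla Y X p.
Proof. by move=> sX sY Up; rewrite (lc_torsion_free hn oU sX sY Up). Qed.

Lemma smooth_lie X Y : smooth_field U X -> smooth_field U Y -> smooth_field U (lie X Y).
Proof.
move=> sX sY; apply: (smooth_field_ext oU) (smooth_fieldB oU (smooth_nabla sX sY) (smooth_nabla sY sX)).
by move=> q Uq; rewrite lie_nabla.
Qed.

Lemma fderivB X f h p : smooth_fun U f -> smooth_fun U h -> U p ->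
  fderiv X (fun q => f q - h q) p = fderiv X f p - fderiv X h p.
Proof.
move=> sf sh Up.
have sN1 := smooth_fun_cst U (-1 : R).
rewrite (fderivD Up sf (smooth_funN oU sh)); congr (_ + _).
have -> : (fun q => - h q) = (fun q => cst (-1 : R) q * h q).
  by apply/funext => q; rewrite mulN1r.
by rewrite (fderivM Up sN1 sh) fderiv_cst mul0r add0r /= mulN1r.
Qed.

(** A nested bracket acts as a nested commutator.  In the Jacobi sum the twelve
    third-order terms cancel in pairs. *)
Lemma fderiv_lie_lie X Y Z f p : smooth_field U X -> smooth_field U Y -> smooth_field U Z ->
  smooth_fun U f -> U p ->
  fderiv (lie X (lie Y Z)) f p =
  fderiv X (fderiv Y (fderiv Z f)) p - fderiv X (fderiv Z (fderiv Y f)) p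
  - (fderiv Y (fderiv Z (fderiv X f)) p - fderiv Z (fderiv Y (fderiv X f)) p).
Proof.
move=> sX sY sZ sf Up.
rewrite (fderiv_lie oU Up sX (smooth_lie sY sZ) sf).
have sXf := smooth_fderiv oU sX sf.
have sYf := smooth_fderiv oU sY sf.
have sZf := smooth_fderiv oU sZ sf.
rewrite (fderiv_lie oU Up sY sZ sXf); congr (_ - _).
rewrite -(fderivB X (smooth_fderiv oU sY sZf) (smooth_fderiv oU sZ sYf) Up).
apply: (fderiv_ext oU Up) => // q Uq.
exact: (fderiv_lie oU Uq sY sZ sf).
Qed.

End Connection.

(** * Tensoriality of the curvature and the first Bianchi identity *)

Section Curvature.
Variables (R : realType) (m : nat) (M : manifold R m) (g : M -> 'M[R]_m).
Variable nabla : (M -> 'cV[R]_m) -> (M -> 'cV[R]_m) -> (M -> 'cV[R]_m).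
Hypothesis hn : levi_civita g nabla.
Implicit Types (p : M) (X Y Z : M -> 'cV[R]_m) (f h : M -> R).

(** Checked on functions, where brackets are commutators. *)
Lemma jacobi (U : set M) X Y Z p : open U -> smooth_field U X -> smooth_field U Y ->
  smooth_field U Z -> U p ->
  lie X (lie Y Z) p + lie Y (lie Z X) p + lie Z (lie X Y) p = 0.
Proof.
move=> oU sX sY sZ Up; apply: (tangent_ext oU Up) => V f oV Vp VU sf.
have [sX' sY' sZ'] := And3 (smooth_field_sub VU sX) (smooth_field_sub VU sY) (smooth_field_sub VU sZ).
have df := smooth_fun_differentiable sf Vp (chart_at_atlas p) (chart_at_dom p).
have tD u v : tderiv p (u + v) f = tderiv p u f + tderiv p v f.
  by rewrite /tderiv -[u]scale1r (derive_lin _ _ _ df) !scale1r.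
have tD3 u v w : tderiv p (u + v + w) f = tderiv p u f + tderiv p v f + tderiv p w f.
  by rewrite tD tD.
rewrite tD3 [RHS]/tderiv derive0.
have aux (a b c xyz xzy yzx zyx yxz zxy : R) : a = xyz - xzy - (yzx - zyx) ->
    b = yzx - yxz - (zxy - xzy) -> c = zxy - zyx - (xyz - yxz) -> a + b + c = 0.
  by move=> -> -> ->; ring.
exact: aux (fderiv_lie_lie hn oV sX' sY' sZ' sf Vp) (fderiv_lie_lie hn oV sY' sZ' sX' sf Vp)
  (fderiv_lie_lie hn oV sZ' sX' sY' sf Vp).
Qed.

Lemma lie_antisym X Y p : lie X Y p = - lie Y X p.
Proof. by rewrite /lie opprB. Qed.

(* Comparing distinct brackets or derivatives must not unfold them to limits. *)
Local Opaque lie tderiv fderiv components gval.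

Variables (U : set M) (oU : open U).

Lemma curvature_ext X X' Y Y' Z Z' p : smooth_field U X -> smooth_field U Y -> smooth_field U Z ->
  (forall q, U q -> X q = X' q) -> (forall q, U q -> Y q = Y' q) ->
  (forall q, U q -> Z q = Z' q) -> U p ->
  curvature nabla X Y Z p = curvature nabla X' Y' Z' p.
Proof.
move=> sX sY sZ XX YY ZZ Up.
have sX' := smooth_field_ext oU XX sX; have sY' := smooth_field_ext oU YY sY.
have sXY := smooth_lie hn oU sX sY.
have sYZ := smooth_nabla hn oU sY sZ; have sXZ := smooth_nabla hn oU sX sZ.
rewrite /curvature; congr (_ - _ - _).
- exact: (nabla_ext hn oU sX sYZ XX (fun q Uq => nabla_ext hn oU sY sZ YY ZZ Uq) Up).
- exact: (nabla_ext hn oU sY sXZ YY (fun q Uq => nabla_ext hn oU sX sZ XX ZZ Uq) Up).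
- apply: (nabla_ext hn oU sXY sZ _ ZZ Up) => q Uq.
  rewrite (lie_nabla hn oU sX sY Uq) (lie_nabla hn oU sX' sY' Uq).
  by rewrite (nabla_ext hn oU sX sY XX YY Uq) (nabla_ext hn oU sY sX YY XX Uq).
Qed.

Lemma curvature_antisym X Y Z p : smooth_field U X -> smooth_field U Y -> smooth_field U Z ->
  U p -> curvature nabla X Y Z p = - curvature nabla Y X Z p.
Proof.
move=> sX sY sZ Up; rewrite /curvature.
have sl := smooth_lie hn oU sY sX.
have aux (a b c d : 'cV[R]_m) : c = - d -> a - b - c = - (b - a - d).
  by move=> ->; apply/matrixP => i j; rewrite !mxE; ring.
apply: aux; rewrite -(nablaNl hn oU sl sZ Up).
apply: (nabla_ext hn oU (smooth_lie hn oU sX sY) sZ _ _ Up) => // q _.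
exact: lie_antisym.
Qed.

(** The derivative of [f] produced by the second iterated covariant derivative cancels
    against the one in the bracket of [f X] with [Y]. *)
Lemma curvature_linl f X X' Y Z p : smooth_fun U f -> smooth_field U X -> smooth_field U X' ->
  smooth_field U Y -> smooth_field U Z -> U p ->
  curvature nabla (fun q => f q *: X q + X' q) Y Z p
  = f p *: curvature nabla X Y Z p + curvature nabla X' Y Z p.
Proof.
move=> sf sX sX' sY sZ Up; rewrite /curvature.
set W := fun q => f q *: X q + X' q.
have sW : smooth_field U W by exact: smooth_fieldZD.
have sYZ := smooth_nabla hn oU sY sZ; have sXZ := smooth_nabla hn oU sX sZ.
have sX'Z := smooth_nabla hn oU sX' sZ.
have sYf := smooth_fderiv oU sY sf.
have sXY := smooth_lie hn oU sX sY; have sX'Y := smooth_lie hn oU sX' sY.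
have E1 := lc_linear hn oU sf sX sX' sYZ Up.
have E2 : nabla Y (nabla W Z) p = fderiv Y f p *: nabla X Z p
    + f p *: nabla Y (nabla X Z) p + nabla Y (nabla X' Z) p.
  rewrite -(lc_leibniz hn oU sf sY sXZ sX'Z Up).
  apply: (nabla_ext hn oU sY (smooth_nabla hn oU sW sZ) _ _ Up) => // q Uq.
  exact: (lc_linear hn oU sf sX sX' sZ Uq).
have E3 : nabla (lie W Y) Z p = f p *: nabla (lie X Y) Z p
   + (- fderiv Y f p *: nabla X Z p + nabla (lie X' Y) Z p).
  have sYfX : smooth_field U (fun q => - fderiv Y f q *: X q + lie X' Y q).
    exact: (smooth_fieldZD oU (smooth_funN oU sYf) sX sX'Y).
  rewrite -(lc_linear hn oU (smooth_funN oU sYf) sX sX'Y sZ Up).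
  rewrite -(lc_linear hn oU sf sXY sYfX sZ Up).
  apply: (nabla_ext hn oU (smooth_lie hn oU sW sY) sZ _ _ Up) => // q Uq.
  have auxl (lW lX lX' wy yw xy yx x'y yx' x : 'cV[R]_m) (r s : R) :
      lW = wy - yw -> lX = xy - yx -> lX' = x'y - yx' ->
      wy = r *: xy + x'y -> yw = s *: x + r *: yx + yx' ->
      lW = r *: lX + (- s *: x + lX').
    by move=> -> -> -> -> ->; apply/matrixP => i j; rewrite !mxE; ring.
  exact: auxl (lie_nabla hn oU sW sY Uq) (lie_nabla hn oU sX sY Uq)
    (lie_nabla hn oU sX' sY Uq) (lc_linear hn oU sf sX sX' sY Uq)
    (lc_leibniz hn oU sf sY sX sX' Uq).
have aux (a b c a1 a2 b1 b2 c1 c2 x : 'cV[R]_m) (r s : R) :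
    a = r *: a1 + a2 -> b = s *: x + r *: b1 + b2 ->
    c = r *: c1 + (- s *: x + c2) ->
    a - b - c = r *: (a1 - b1 - c1) + (a2 - b2 - c2).
  by move=> -> -> ->; apply/matrixP => i j; rewrite !mxE; ring.
exact: aux E1 E2 E3.
Qed.

(** The second derivatives of [f] combine to the commutator minus the bracket acting
    on [f], which is zero by [fderiv_lie]. *)
Lemma curvature_linr f X Y Z Z' p : smooth_fun U f -> smooth_field U X ->
  smooth_field U Y -> smooth_field U Z -> smooth_field U Z' -> U p ->
  curvature nabla X Y (fun q => f q *: Z q + Z' q) p
  = f p *: curvature nabla X Y Z p + curvature nabla X Y Z' p.
Proof.
move=> sf sX sY sZ sZ' Up; rewrite /curvature.
set W := fun q => f q *: Z q + Z' q.
have sW : smooth_field U W by exact: smooth_fieldZD.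
have sXY := smooth_lie hn oU sX sY.
have second A B : smooth_field U A -> smooth_field U B ->
  nabla A (nabla B W) p = fderiv A (fderiv B f) p *: Z p + fderiv B f p *: nabla A Z p
    + (fderiv A f p *: nabla B Z p + f p *: nabla A (nabla B Z) p + nabla A (nabla B Z') p).
  move=> sA sB; have sBf := smooth_fderiv oU sB sf.
  have sBZ := smooth_nabla hn oU sB sZ; have sBZ' := smooth_nabla hn oU sB sZ'.
  have s2 : smooth_field U (fun q => f q *: nabla B Z q + nabla B Z' q) by exact: smooth_fieldZD.
  rewrite -(lc_leibniz hn oU sf sA sBZ sBZ' Up) -(lc_leibniz hn oU sBf sA sZ s2 Up).
  apply: (nabla_ext hn oU sA (smooth_nabla hn oU sB sW) _ _ Up) => // q Uq.
  by rewrite (lc_leibniz hn oU sf sB sZ sZ' Uq) addrA.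
have aux (a b c x z y a1 a2 b1 b2 c1 c2 : 'cV[R]_m) (rxy ryx rx ry r s : R) :
    a = rxy *: z + ry *: x + (rx *: y + r *: a1 + a2) ->
    b = ryx *: z + rx *: y + (ry *: x + r *: b1 + b2) ->
    c = s *: z + r *: c1 + c2 -> s = rxy - ryx ->
    a - b - c = r *: (a1 - b1 - c1) + (a2 - b2 - c2).
  by move=> -> -> -> ->; apply/matrixP => i j; rewrite !mxE; ring.
exact: aux (second X Y sX sY) (second Y X sY sX)
  (lc_leibniz hn oU sf sXY sZ sZ' Up) (fderiv_lie oU Up sX sY sf).
Qed.

(** Since the torsion vanishes, the cyclic sum regroups into iterated brackets, and
    the Jacobi identity applies. *)
Lemma curvature_bianchi X Y Z p : smooth_field U X ->
  smooth_field U Y -> smooth_field U Z -> U p ->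
  curvature nabla X Y Z p + curvature nabla Y Z X p + curvature nabla Z X Y p = 0.
Proof.
move=> sX sY sZ Up; rewrite -(jacobi oU sX sY sZ Up) /curvature.
have lie2 A B C : smooth_field U A -> smooth_field U B -> smooth_field U C ->
  lie A (lie B C) p = nabla A (nabla B C) p - nabla A (nabla C B) p - nabla (lie B C) A p.
  move=> sA sB sC; have sBC := smooth_lie hn oU sB sC.
  have s1 := smooth_nabla hn oU sB sC; have s2 := smooth_nabla hn oU sC sB.
  rewrite (lie_nabla hn oU sA sBC Up); congr (_ - _).
  rewrite -(nablaNr hn oU sA s2 Up) -(nablaDr hn oU sA s1 (smooth_fieldN oU s2) Up).
  apply: (nabla_ext hn oU sA sBC _ _ Up) => // q Uq.
  exact: (lie_nabla hn oU sB sC Uq).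
have aux (lx ly lz xyz xzy yzx yxz zxy zyx a b c : 'cV[R]_m) :
    lx = xyz - xzy - a -> ly = yzx - yxz - b -> lz = zxy - zyx - c ->
    (xyz - yxz - c) + (yzx - zyx - a) + (zxy - xzy - b) = lx + ly + lz.
  by move=> -> -> ->; apply/matrixP => i j; rewrite !mxE; ring.
exact: aux (lie2 X Y Z sX sY sZ) (lie2 Y Z X sY sZ sX) (lie2 Z X Y sZ sX sY).
Qed.

Lemma curvature_suml n (a : 'I_n -> M -> R) (F : 'I_n -> M -> 'cV[R]_m) Y Z p :
  (forall i, smooth_fun U (a i)) -> (forall i, smooth_field U (F i)) ->
  smooth_field U Y -> smooth_field U Z -> U p ->
  curvature nabla (fun q => \sum_i a i q *: F i q) Y Z p
  = \sum_i a i p *: curvature nabla (F i) Y Z p.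
Proof.
move=> sa sF sY sZ Up; elim: n a F sa sF => [|n IH] a F sa sF.
  have -> : (fun q => \sum_i a i q *: F i q) = (fun _ => 0 *: 0 + 0).
    by apply/funext => q; rewrite big_ord0 scaler0 addr0.
  have s0 := @smooth_field0 R m M U.
  rewrite (@curvature_linl (cst 0) (fun _ => 0) (fun _ => 0)) //; last exact: smooth_fun_cst.
  rewrite big_ord0 scale0r add0r /curvature.
  have s1 := smooth_nabla hn oU sY sZ.
  rewrite (nabla0l hn oU s1 Up) sub0r.
  have -> : nabla Y (nabla (fun _ => 0) Z) p = nabla Y (fun _ => 0) p.
    apply: (nabla_ext hn oU sY (smooth_nabla hn oU s0 sZ) _ _ Up) => // q Uq.
    exact: (nabla0l hn oU sZ Uq).
  rewrite (nabla0r hn oU sY Up) oppr0 sub0r.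
  have -> : nabla (lie (fun _ => 0) Y) Z p = nabla (fun _ => 0) Z p.
    apply: (nabla_ext hn oU (smooth_lie hn oU s0 sY) sZ _ _ Up) => // q Uq.
    by rewrite (lie_nabla hn oU s0 sY Uq) (nabla0l hn oU sY Uq) (nabla0r hn oU sY Uq) subr0.
  by rewrite (nabla0l hn oU sZ Up) oppr0.
have -> : (fun q => \sum_i a i q *: F i q) =
  (fun q => a ord0 q *: F ord0 q + (fun r => \sum_i a (lift ord0 i) r *: F (lift ord0 i) r) q).
  by apply/funext => q; rewrite big_ord_recl.
have sT : smooth_field U (fun r => \sum_i a (lift ord0 i) r *: F (lift ord0 i) r).
  apply: (@smooth_field_sum R m M U n (fun i q => a (lift ord0 i) q *: F (lift ord0 i) q) oU) => i.
  exact: (smooth_fieldZ oU (sa _) (sF _)).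
rewrite (curvature_linl (sa ord0) (sF ord0) sT sY sZ Up) big_ord_recl.
by rewrite (IH _ _ (fun i => sa (lift ord0 i)) (fun i => sF (lift ord0 i))).
Qed.

Lemma curvature_sumr n (a : 'I_n -> M -> R) (F : 'I_n -> M -> 'cV[R]_m) X Y p :
  (forall i, smooth_fun U (a i)) -> (forall i, smooth_field U (F i)) ->
  smooth_field U X -> smooth_field U Y -> U p ->
  curvature nabla X Y (fun q => \sum_i a i q *: F i q) p
  = \sum_i a i p *: curvature nabla X Y (F i) p.
Proof.
move=> sa sF sX sY Up; elim: n a F sa sF => [|n IH] a F sa sF.
  have -> : (fun q => \sum_i a i q *: F i q) = (fun _ => 0).
    by apply/funext => q; rewrite big_ord0.
  have s0 := @smooth_field0 R m M U.
  have sl := smooth_lie hn oU sX sY.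
  have z A B : smooth_field U A -> smooth_field U B -> nabla A (nabla B (fun _ => 0)) p = 0.
    move=> sA sB; rewrite -[RHS](nabla0r hn oU sA Up).
    apply: (nabla_ext hn oU sA (smooth_nabla hn oU sB s0) _ _ Up) => // q Uq.
    exact: (nabla0r hn oU sB Uq).
  by rewrite big_ord0 /curvature z // z // (nabla0r hn oU) // !subr0.
have -> : (fun q => \sum_i a i q *: F i q) =
  (fun q => a ord0 q *: F ord0 q + (fun r => \sum_i a (lift ord0 i) r *: F (lift ord0 i) r) q).
  by apply/funext => q; rewrite big_ord_recl.
have sT : smooth_field U (fun r => \sum_i a (lift ord0 i) r *: F (lift ord0 i) r).
  apply: (@smooth_field_sum R m M U n (fun i q => a (lift ord0 i) q *: F (lift ord0 i) q) oU) => i.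
  exact: (smooth_fieldZ oU (sa _) (sF _)).
rewrite (curvature_linr (sa ord0) sX sY (sF ord0) sT Up) big_ord_recl.
by rewrite (IH _ _ (fun i => sa (lift ord0 i)) (fun i => sF (lift ord0 i))).
Qed.

End Curvature.

(** * Curvature in an orthonormal moving frame *)

Section Frame.
Variables (R : realType) (m : nat) (M : manifold R m) (g : M -> 'M[R]_m).
Variable nabla : (M -> 'cV[R]_m) -> (M -> 'cV[R]_m) -> (M -> 'cV[R]_m).
Hypothesis hg : riemannian_metric g.
Hypothesis hn : levi_civita g nabla.
Variables (U : set M) (oU : open U).
Variable E : 'I_m -> M -> 'cV[R]_m.
Hypothesis sE : forall i, smooth_field U (E i).
Hypothesis oE : forall q, U q -> orthonormal g q (fun i => E i q).
Implicit Types (p : M) (X Y Z : M -> 'cV[R]_m) (f h : M -> R).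

Definition connection_coef i j k q : R := gval g q (nabla (E i) (E j) q) (E k q).

Definition riemann_coef p i j k l : R := gval g p (curvature nabla (E i) (E j) (E k) p) (E l p).

Lemma smooth_gval X Y : smooth_field U X -> smooth_field U Y ->
  smooth_fun U (fun q => gval g q (X q) (Y q)).
Proof. exact: (metric_smooth hg oU). Qed.

Lemma smooth_connection i j k : smooth_fun U (connection_coef i j k).
Proof. exact: (smooth_gval (smooth_nabla hn oU (sE i) (sE j)) (sE k)). Qed.

Lemma frame_expand X q : U q -> X q = \sum_i gval g q (X q) (E i q) *: E i q.
Proof. by move=> Uq; exact: (orthonormal_expand hg (X q) (oE Uq)). Qed.

Lemma fderiv_locally_cst X f (a : R) p : U p -> (forall q, U q -> f q = a) -> fderiv X f p = 0.
Proof.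
move=> Up fa; rewrite -(fderiv_cst p X a); exact: (fderiv_ext oU Up).
Qed.

(** The inner products of the frame are constant. *)
Lemma connection_skew i j k p : U p -> connection_coef i k j p = - connection_coef i j k p.
Proof.
move=> Up; have := lc_metric hn oU (sE i) (sE j) (sE k) Up.
rewrite (fderiv_locally_cst (a := (j == k)%:R) _ Up); last by move=> q Uq; exact: oE.
rewrite (metric_sym hg p (E j p)) => /eqP; rewrite eq_sym addr_eq0 => /eqP H.
by rewrite /connection_coef H opprK.
Qed.

Lemma nabla_frame i j p : U p -> nabla (E i) (E j) p = \sum_k connection_coef i j k p *: E k p.
Proof. exact: frame_expand. Qed.

Lemma nabla_lie_frame i j k p : U p ->
  nabla (lie (E i) (E j)) (E k) p = \sum_n (connection_coef i j n p - connection_coef j i n p) *: nabla (E n) (E k) p.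
Proof.
move=> Up.
have sl := smooth_lie hn oU (sE i) (sE j).
have sa n : smooth_fun U (fun q => connection_coef i j n q - connection_coef j i n q).
  exact: (smooth_funD oU (smooth_connection i j n) (smooth_funN oU (smooth_connection j i n))).
rewrite -(nabla_suml hn oU sa sE (sE k) Up).
apply: (nabla_ext hn oU sl (sE k) _ _ Up) => // q Uq.
rewrite (lie_nabla hn oU (sE i) (sE j) Uq) !(nabla_frame _ _ Uq) -sumrB.
by apply: eq_bigr => n _; rewrite scalerBl.
Qed.

(** The structure equation in an orthonormal frame.  The terms quadratic in the
    connection come from the metric property: one derivative is moved off
    the first covariant derivative onto [E l]. *)
Lemma riemann_structure i j k l p : U p ->
  riemann_coef p i j k l = fderiv (E i) (connection_coef j k l) p - fderiv (E j) (connection_coef i k l) p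
   - \sum_n (connection_coef j k n p * connection_coef i l n p - connection_coef i k n p * connection_coef j l n p
             + (connection_coef i j n p - connection_coef j i n p) * connection_coef n k l p).
Proof.
move=> Up.
have D i' j' : gval g p (nabla (E i') (nabla (E j') (E k)) p) (E l p)
   = fderiv (E i') (connection_coef j' k l) p - \sum_n connection_coef j' k n p * connection_coef i' l n p.
  have sn := smooth_nabla hn oU (sE j') (sE k).
  have H : fderiv (E i') (connection_coef j' k l) p = _ := lc_metric hn oU (sE i') sn (sE l) Up.
  rewrite H (parseval hg (nabla (E j') (E k) p) (nabla (E i') (E l) p) (oE Up)).
  by rewrite addrK.
rewrite /riemann_coef /curvature !gvalDl !gvalNl !D (nabla_lie_frame _ _ _ Up) gval_suml.
rewrite big_split /= sumrB.
have -> : \sum_n gval g p ((connection_coef i j n p - connection_coef j i n p) *: nabla (E n) (E k) p) (E l p)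
  = \sum_n (connection_coef i j n p - connection_coef j i n p) * connection_coef n k l p.
  by apply: eq_bigr => n _; rewrite gvalZl.
have aux (a b c d e : R) : a - b - (c - d) - e = a - c - (b - d + e) by ring.
exact: aux.
Qed.

Lemma riemann_antisym i j k l p : U p -> riemann_coef p j i k l = - riemann_coef p i j k l.
Proof.
by move=> Up; rewrite /riemann_coef (curvature_antisym hn oU (sE j) (sE i) (sE k) Up) gvalNl.
Qed.

Lemma fderiv_connection_skew a i j k p : U p ->
  fderiv (E a) (connection_coef i k j) p = - fderiv (E a) (connection_coef i j k) p.
Proof.
move=> Up.
have -> : fderiv (E a) (connection_coef i k j) p = fderiv (E a) (fun q => cst 0 q - connection_coef i j k q) p.
  by apply: (fderiv_ext oU Up) => // q Uq; rewrite connection_skew // sub0r.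
by rewrite (fderivB oU _ (smooth_fun_cst U 0) (smooth_connection i j k) Up) fderiv_cst sub0r.
Qed.

Lemma riemann_skew i j k l p : U p -> riemann_coef p i j l k = - riemann_coef p i j k l.
Proof.
move=> Up; rewrite !(riemann_structure _ _ _ _ Up).
rewrite !(fderiv_connection_skew _ _ k l Up).
have -> : \sum_n (connection_coef j l n p * connection_coef i k n p - connection_coef i l n p * connection_coef j k n p
       + (connection_coef i j n p - connection_coef j i n p) * connection_coef n l k p)
  = - \sum_n (connection_coef j k n p * connection_coef i l n p - connection_coef i k n p * connection_coef j l n p
       + (connection_coef i j n p - connection_coef j i n p) * connection_coef n k l p).
  by rewrite -sumrN; apply: eq_bigr => n _; rewrite (connection_skew n k l Up); ring.
by ring.
Qed.

Lemma riemann_bianchi i j k l p : U p -> riemann_coef p i j k l + riemann_coef p j k i l + riemann_coef p k i j l = 0.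
Proof.
move=> Up; rewrite /riemann_coef -!gvalDl.
by rewrite (curvature_bianchi hn oU (sE i) (sE j) (sE k) Up) gval0l.
Qed.

(** Each coordinate field is expanded in the frame near [p]; tensoriality
    turns its coefficients into their values at [p]. *)
Lemma curv_frame p u v w : U p ->
  curv nabla p u v w = \sum_i \sum_j \sum_k
    (gval g p u (E i p) * gval g p v (E j p) * gval g p w (E k p))
      *: curvature nabla (E i) (E j) (E k) p.
Proof.
move=> Up; rewrite /curv.
pose V := U `&` chart_dom (chart_at p).
have oV : open V by apply: openI => //; exact: chart_dom_open.
have Vp : V p by split => //; exact: chart_at_dom.
have VU : V `<=` U by move=> q [].
have VD : V `<=` chart_dom (chart_at p) by move=> q [].
have sEV i : smooth_field V (E i) := smooth_field_sub VU (sE i).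
have se t : smooth_field V (extend p t) := smooth_field_sub VD (smooth_extend p t).
have sa t i : smooth_fun V (fun q => gval g q (extend p t q) (E i q)).
  exact: (metric_smooth hg oV (se t) (sEV i)).
have xp t q : V q -> extend p t q = \sum_i gval g q (extend p t q) (E i q) *: E i q.
  by move=> [Uq _]; exact: (orthonormal_expand hg _ (oE Uq)).
have at_p t i : gval g p (extend p t p) (E i p) = gval g p t (E i p) by rewrite extend_at.
rewrite (curvature_ext hn oV (se u) (se v) (se w) (fun q => @xp u q)
  (fun q _ => erefl _) (fun q _ => erefl _) Vp).
rewrite (curvature_suml hn oV (sa u) sEV (se v) (se w) Vp).
apply: eq_bigr => i _.
rewrite (curvature_antisym hn oV (sEV i) (se v) (se w) Vp).
rewrite (curvature_ext hn oV (se v) (sEV i) (se w) (fun q => @xp v q)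
  (fun q _ => erefl _) (fun q _ => erefl _) Vp).
rewrite (curvature_suml hn oV (sa v) sEV (sEV i) (se w) Vp) -sumrN scaler_sumr.
apply: eq_bigr => j _.
rewrite -scalerN -(curvature_antisym hn oV (sEV i) (sEV j) (se w) Vp).
rewrite (curvature_ext hn oV (sEV i) (sEV j) (se w) (fun q _ => erefl _)
  (fun q _ => erefl _) (fun q => @xp w q) Vp).
rewrite (curvature_sumr hn oV (sa w) sEV (sEV i) (sEV j) Vp) !scaler_sumr.
by apply: eq_bigr => k _; rewrite !scalerA (at_p u i) (at_p v j) (at_p w k).
Qed.

Lemma curv4_frame p i j k l : U p ->
  curv4 g nabla p (E i p) (E j p) (E k p) (E l p) = riemann_coef p i j k l.
Proof.
move=> Up; rewrite /curv4 (curv_frame _ _ _ Up) /riemann_coef; congr (gval g p _ _).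
have pick n (F : 'I_m -> 'cV[R]_m) : \sum_a (gval g p (E n p) (E a p)) *: F a = F n.
  rewrite (bigD1 n) //= (oE Up) eqxx scale1r big1 ?addr0 // => a an.
  by rewrite (oE Up) eq_sym (negbTE an) scale0r.
rewrite -[RHS](pick i (fun a => curvature nabla (E a) (E j) (E k) p)).
apply: eq_bigr => a _.
rewrite -(pick j (fun b => curvature nabla (E a) (E b) (E k) p)) scaler_sumr.
apply: eq_bigr => b _.
rewrite -(pick k (fun c => curvature nabla (E a) (E b) (E c) p)) !scaler_sumr.
by apply: eq_bigr => c _; rewrite !scalerA.
Qed.

Lemma curv4_expand p u v w z : U p ->
  curv4 g nabla p u v w z = \sum_i \sum_j \sum_k \sum_l
    gval g p u (E i p) * gval g p v (E j p) * gval g p w (E k p) * gval g p z (E l p)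
      * riemann_coef p i j k l.
Proof.
move=> Up; rewrite /curv4 (curv_frame _ _ _ Up) gval_suml.
apply: eq_bigr => i _; rewrite gval_suml; apply: eq_bigr => j _.
rewrite gval_suml; apply: eq_bigr => k _.
rewrite gvalZl (orthonormal_expand hg z (oE Up)) gval_sumr mulr_sumr.
apply: eq_bigr => l _.
by rewrite gvalZr -(orthonormal_expand hg z (oE Up)) mulrA /riemann_coef.
Qed.

End Frame.

(** * Identities between connection coefficients in dimension three *)

Local Notation i0 := (@Ordinal 3 0 isT).
Local Notation i1 := (@Ordinal 3 1 isT).
Local Notation i2 := (@Ordinal 3 2 isT).

Lemma sum3 (V : nmodType) (F : 'I_3 -> V) : \sum_i F i = F i0 + F i1 + F i2.
Proof.
rewrite !big_ord_recl big_ord0 addr0 addrA.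
by congr (F _ + F _ + F _); apply: val_inj.
Qed.

Lemma ord3_ind (P : 'I_3 -> Prop) : P i0 -> P i1 -> P i2 -> forall i, P i.
Proof.
move=> P0 P1 P2 [[|[|[|n]]] lt3] //.
- by rewrite (_ : Ordinal lt3 = i0) //; apply: val_inj.
- by rewrite (_ : Ordinal lt3 = i1) //; apply: val_inj.
- by rewrite (_ : Ordinal lt3 = i2) //; apply: val_inj.
Qed.

(* Below, [G i j k] stands for the connection coefficients of an orthonormal frame
   [E0 = xi], [E1], [E2] at one point, and [D a i j k] for the derivative of the
   coefficient function along [E a].  Treating them as independent numbers leaves
   polynomial identities. *)

Section StructureFunctions.
Variable R : realType.
Variables (G : 'I_3 -> 'I_3 -> 'I_3 -> R) (D : 'I_3 -> 'I_3 -> 'I_3 -> 'I_3 -> R).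

Definition structure_riemann i j k l : R := D i j k l - D j i k l
   - \sum_n (G j k n * G i l n - G i k n * G j l n + (G i j n - G j i n) * G n k l).

Hypothesis Gskew : forall i j k, G i k j = - G i j k.
Hypothesis Dskew : forall a i j k, D a i k j = - D a i j k.
Hypothesis G00 : forall k, G i0 i0 k = 0.
Hypothesis D00 : forall a k, D a i0 i0 k = 0.

Let Gdiag i j : G i j j = 0.
Proof. by have := Gskew i j j; lra. Qed.

Let Ddiag a i j : D a i j j = 0.
Proof. by have := Dskew a i j j; lra. Qed.

Let Gred := (G00, Gdiag, fun i => Gskew i i0 i1, fun i => Gskew i i0 i2, fun i => Gskew i i1 i2).
Let Dred := (D00, Ddiag, fun a i => Dskew a i i0 i1, fun a i => Dskew a i i0 i2,
             fun a i => Dskew a i i1 i2).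

(** The cyclic sum is twice the trace of [N]: the derivatives cancel and the remaining
    terms are the trace times the skew part. *)
Lemma trace_identity : D i0 i1 i0 i2 = D i0 i2 i0 i1 ->
  G i1 i0 i2 - G i2 i0 i1 = -2 ->
  structure_riemann i0 i1 i2 i0 + structure_riemann i1 i2 i0 i0 + structure_riemann i2 i0 i1 i0 = 0 ->
  G i1 i0 i1 + G i2 i0 i2 = 0.
Proof.
move=> eD eG; have Rdiag i j k : structure_riemann i j k k = 0.
  by rewrite /structure_riemann !sum3 !Gdiag !Ddiag; ring.
rewrite Rdiag /structure_riemann !sum3 !Gred !Dred eD.
have -> : G i1 i0 i2 = G i2 i0 i1 - 2 by lra.
move=> H; apply: (@mulfI _ (2 : R)); first by rewrite pnatr_eq0.
by rewrite mulr0 -{}H; ring.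
Qed.

(** The Ricci curvature of [xi] is minus the derivative of the trace of [N] minus the
    trace of [N^2]; for trace-free [N] that trace is twice the left-hand side below. *)
Lemma nilpotency_identity : D i0 i1 i0 i1 + D i0 i2 i0 i2 = 0 ->
  G i1 i0 i1 + G i2 i0 i2 = 0 ->
  structure_riemann i0 i0 i0 i0 + structure_riemann i1 i0 i0 i1 + structure_riemann i2 i0 i0 i2 = 0 ->
  G i1 i0 i1 ^+ 2 + G i1 i0 i2 * G i2 i0 i1 = 0.
Proof.
move=> eD eG; rewrite /structure_riemann !sum3 !Gred !Dred.
have -> : D i0 i2 i0 i2 = - D i0 i1 i0 i1 by lra.
have -> : G i2 i0 i2 = - G i1 i0 i1 by lra.
move=> H; apply: (@mulfI _ (2 : R)); first by rewrite pnatr_eq0.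
by rewrite mulr0 -[RHS]oppr0 -{}H; ring.
Qed.

(* From here on the frame is the special one, where [N E2 = 0] and [N E1 = - 2 E2]. *)
Hypothesis G2 : forall k, G i2 i0 k = 0.
Hypothesis D2 : forall a k, D a i2 i0 k = 0.
Hypothesis G1 : G i1 i0 i1 = 0.
Hypothesis G12 : G i1 i0 i2 = -2.
Hypothesis D1 : forall a k, D a i1 i0 k = 0.

Lemma first_order_identity : structure_riemann i1 i2 i0 i1 = - 2 * G i2 i1 i2 /\
  structure_riemann i1 i2 i0 i2 = - 2 * G i1 i1 i2.
Proof. by rewrite /structure_riemann !sum3 !Gred !G2 !G1 !G12 ?D1 ?D2 ?Gred ?Dred; split; ring. Qed.

Hypothesis Gb : G i1 i1 i2 = 0.
Hypothesis Gd : G i2 i1 i2 = 0.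
Hypothesis Db : forall a, D a i1 i1 i2 = 0.
Hypothesis Dd : forall a, D a i2 i1 i2 = 0.

Lemma curvature_identities :
  [/\ structure_riemann i0 i1 i0 i1 = 2 * G i0 i1 i2, structure_riemann i0 i1 i0 i2 = 0,
      structure_riemann i0 i2 i0 i1 = 0, structure_riemann i0 i2 i0 i2 = - 2 * G i0 i1 i2 &
      structure_riemann i1 i2 i1 i2 = - 2 * G i0 i1 i2].
Proof.
by split; rewrite /structure_riemann !sum3 !Gred ?G2 ?G1 ?G12 ?D1 ?D2 ?Db ?Dd ?Gb ?Gd ?Gred ?Dred
  ?D1 ?D2 ?Db ?Dd ?D00 ?G2 ?G1 ?G12; ring.
Qed.

End StructureFunctions.

(** * Pointwise algebra of an almost contact metric structure *)

Section Contact.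
Variables (R : realType) (m : nat) (M : manifold R m).
Variables (phi : M -> 'M[R]_m) (xi : M -> 'cV[R]_m) (eta : M -> 'rV[R]_m) (g : M -> 'M[R]_m).
Hypothesis ha : almost_contact_metric phi xi eta g.
Implicit Types (p : M) (u v : 'cV[R]_m).

Let hg : riemannian_metric g := acm_metric ha.

Let eta0 p : form_val eta p 0 = 0.
Proof. by rewrite /form_val mulmx0 mxE. Qed.

Lemma xi_neq0 p : xi p != 0.
Proof.
apply/eqP => x0; have := acm_eta_xi ha p; rewrite x0 eta0 => /eqP.
by rewrite eq_sym oner_eq0.
Qed.

(** Applying [phi] once more to [phi xi], which [phi] kills, shows that [phi xi] is
    a multiple [a] of [xi]; then [phi (phi xi) = a^2 xi = 0]. *)
Lemma phi_xi p : phi p *m xi p = 0.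
Proof.
set w := phi p *m xi p.
have w2 : phi p *m w = 0.
  by rewrite (acm_phi2 ha) (acm_eta_xi ha) scale1r addNr.
have : phi p *m (phi p *m w) = - w + form_val eta p w *: xi p by rewrite (acm_phi2 ha).
rewrite w2 mulmx0 => /eqP; rewrite eq_sym addrC subr_eq0 => /eqP.
move: (form_val eta p w) => a wE.
move: w2; rewrite -wE -scalemxAr -/w -wE scalerA => /eqP.
rewrite scaler_eq0 (negbTE (xi_neq0 p)) orbF mulf_eq0 orbb => /eqP e0.
by rewrite e0 scale0r.
Qed.

(** Compute [phi^3] in the two possible ways. *)
Lemma eta_phi p u : form_val eta p (phi p *m u) = 0.
Proof.
have H : phi p *m (phi p *m (phi p *m u)) = - (phi p *m u).
  by rewrite [X in _ *m X](acm_phi2 ha) mulmxDr mulmxN -scalemxAr phi_xi scaler0 addr0.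
move: H; rewrite (acm_phi2 ha) -[RHS]addr0 => /addrI /eqP.
by rewrite scaler_eq0 (negbTE (xi_neq0 p)) orbF => /eqP.
Qed.

Lemma eta_gval p u : form_val eta p u = gval g p u (xi p).
Proof.
have := acm_compatible ha p u (xi p).
rewrite phi_xi gval0r (acm_eta_xi ha) mulr1 => /eqP.
by rewrite eq_sym subr_eq0 => /eqP.
Qed.

Lemma xi_unit p : gval g p (xi p) (xi p) = 1.
Proof. by rewrite -eta_gval (acm_eta_xi ha). Qed.

Lemma phi_perp p u : gval g p (phi p *m u) (xi p) = 0.
Proof. by rewrite -eta_gval eta_phi. Qed.

Lemma phi_skew p u v : gval g p u (phi p *m v) = - gval g p (phi p *m u) v.
Proof.
have := acm_compatible ha p u (phi p *m v).
rewrite eta_phi mulr0 subr0 => <-.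
by rewrite (acm_phi2 ha) gvalDr gvalNr gvalZr phi_perp mulr0 addr0.
Qed.

Lemma phi_phi_perp p u : gval g p u (xi p) = 0 -> phi p *m (phi p *m u) = - u.
Proof. by move=> u0; rewrite (acm_phi2 ha) eta_gval u0 scale0r addr0. Qed.

Lemma phi_isometry p u v : gval g p u (xi p) = 0 ->
  gval g p (phi p *m u) (phi p *m v) = gval g p u v.
Proof. by move=> u0; rewrite (acm_compatible ha) eta_gval u0 mul0r subr0. Qed.

End Contact.

(** * Frames adapted to the contact structure *)

Section Normalize.
Variables (R : realType) (m : nat) (M : manifold R m) (g : M -> 'M[R]_m).
Hypothesis hg : riemannian_metric g.

Lemma smooth_fun_continuous (V : set M) (f : M -> R) p : smooth_fun V f -> V p ->
  {for p, continuous f}.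
Proof.
move=> sf Vp; set c := chart_at p.
have ac : atlas c := chart_at_atlas p; have cp : chart_dom c p := chart_at_dom p.
have cf : {for coord c p, continuous (f \o chart_inv c)}.
  exact/differentiable_continuous/(smooth_fun_differentiable sf Vp ac cp).
have := continuous_comp (coord_continuous cp) cf.
rewrite /prop_for /continuous_at /= coordK // => H.
apply: cvg_trans H; apply: near_eq_cvg.
by apply: filterS (dom_near cp) => q cq /=; rewrite coordK.
Qed.

Lemma normalize (V : set M) (W : M -> 'cV[R]_m) p : open V -> V p ->
  smooth_field V W -> W p != 0 ->
  exists U (a : M -> R), [/\ open U, U p, U `<=` V, smooth_fun U a &
    forall q, U q -> a q * a q * gval g q (W q) (W q) = 1].
Proof.
move=> oV Vp sW Wp.
pose f q := gval g q (W q) (W q).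
have sf : smooth_fun V f by exact: (metric_smooth hg oV sW sW).
have fp : 0 < f p := metric_pos hg p Wp.
pose U := interior [set q | V q /\ 0 < f q].
have UV q : U q -> V q /\ 0 < f q by move=> /interior_subset.
have oU : open U by exact: open_interior.
have Up : U p.
  apply: filterI; first exact: open_nbhs_nbhs.
  exact: (cvgr_gt _ (smooth_fun_continuous sf Vp) _ fp).
have VU : U `<=` V by move=> q /UV [].
exists U, (fun q => (Num.sqrt (f q))^-1); split => //.
  apply: (smooth_fun_normalizer oU) (smooth_fun_sub VU sf).
  by move=> q /UV [].
move=> q /UV [_ fq].
rewrite -invfM -expr2 sqr_sqrtr; last exact: ltW.
by rewrite mulVf // gt_eqF.
Qed.

End Normalize.

Section Contact3.
Variables (R : realType) (M : manifold R 3).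
Variables (phi : M -> 'M[R]_3) (xi : M -> 'cV[R]_3) (eta : M -> 'rV[R]_3) (g : M -> 'M[R]_3).
Variable nabla : (M -> 'cV[R]_3) -> (M -> 'cV[R]_3) -> (M -> 'cV[R]_3).
Hypothesis hc : contact_metric phi xi eta g.
Hypothesis hn : levi_civita g nabla.
Hypothesis hric : forall p e v, orthonormal g p e -> ricci g nabla p e (xi p) v = 0.

Let ha : almost_contact_metric phi xi eta g := cm_almost hc.
Let hg : riemannian_metric g := acm_metric ha.

Let smooth_xi (U : set M) : smooth_field U xi.
Proof. exact: smooth_field_sub (acm_xi_smooth ha). Qed.

(** The contact condition determines the skew part of [N]. *)
Lemma deta_nabla (U : set M) X Y p : open U -> smooth_field U X -> smooth_field U Y -> U p ->
  gval g p (nabla X xi p) (Y p) - gval g p (nabla Y xi p) (X p)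
  = 2 * gval g p (X p) (phi p *m Y p).
Proof.
move=> oU sX sY Up; rewrite -(cm_deta hc oU sX sY Up) /dform.
have eE (Z : M -> 'cV[R]_3) : (fun q => form_val eta q (Z q)) = (fun q => gval g q (Z q) (xi q)).
  by apply/funext => q; rewrite (eta_gval ha).
rewrite !eE (eta_gval ha) (lie_nabla hn oU sX sY Up).
rewrite (lc_metric hn oU sX sY (smooth_xi U) Up) (lc_metric hn oU sY sX (smooth_xi U) Up).
rewrite gvalDl gvalNl (metric_sym hg p (Y p) (nabla X xi p)).
rewrite (metric_sym hg p (X p) (nabla Y xi p)).
move: (gval g p (nabla X Y p) (xi p)) (gval g p (nabla Y X p) (xi p)).
move: (gval g p (nabla X xi p) (Y p)) (gval g p (nabla Y xi p) (X p)).
by move=> a b c d; field.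
Qed.

(** Local unit sections of the contact plane. *)
Definition adapted (U : set M) (e1 : M -> 'cV[R]_3) : Prop :=
  smooth_field U e1 /\ forall q, U q ->
    gval g q (e1 q) (e1 q) = 1 /\ gval g q (e1 q) (xi q) = 0.

Definition contact_frame (e1 : M -> 'cV[R]_3) (i : 'I_3) : M -> 'cV[R]_3 :=
  match val i with 0%N => xi | 1%N => e1 | _ => fun q => phi q *m e1 q end.

Section Adapted.
Variables (U : set M) (oU : open U) (e1 : M -> 'cV[R]_3) (he : adapted U e1).
Local Notation E := (contact_frame e1).

Lemma smooth_contact_frame i : smooth_field U (E i).
Proof.
elim/ord3_ind: i; [exact: smooth_xi|exact: he.1|].
exact: (acm_phi_smooth ha oU he.1).
Qed.

Lemma orthonormal_contact_frame q : U q -> orthonormal g q (fun i => E i q).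
Proof.
move=> Uq; have [u1 p1] := he.2 q Uq.
have pe : gval g q (phi q *m e1 q) (e1 q) = 0.
  by have := phi_skew ha q (e1 q) (e1 q); rewrite (metric_sym hg q (e1 q)); lra.
have pp : gval g q (phi q *m e1 q) (phi q *m e1 q) = 1 by rewrite (phi_isometry ha _ p1).
move=> i j; elim/ord3_ind: i; elim/ord3_ind: j; rewrite /contact_frame /=.
- exact: (xi_unit ha).
- by rewrite (metric_sym hg) p1.
- by rewrite (metric_sym hg) (phi_perp ha).
- exact: p1.
- exact: u1.
- by rewrite (metric_sym hg) pe.
- exact: (phi_perp ha).
- exact: pe.
- exact: pp.
Qed.

Local Notation sE := smooth_contact_frame.
Local Notation oE := orthonormal_contact_frame.
Local Notation G i j k q := (connection_coef g nabla E i j k q).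

Lemma contact_frame_skew i j q : U q ->
  G i i0 j q - G j i0 i q = 2 * gval g q (E i q) (phi q *m E j q).
Proof. by move=> Uq; rewrite -(deta_nabla oU (sE i) (sE j) Uq). Qed.

Lemma connection_xi_perp i q : U q -> G i i0 i0 q = 0.
Proof. by move=> Uq; have := connection_skew hg hn oU sE oE i i0 i0 Uq; lra. Qed.

(** Contact metric structures have geodesic Reeb orbits: the skew part of [N]
    vanishes on [xi], and [N] takes values orthogonal to [xi]. *)
Lemma connection_xi_xi k q : U q -> G i0 i0 k q = 0.
Proof.
move=> Uq; have := contact_frame_skew i0 k Uq.
rewrite (connection_xi_perp k Uq) subr0 => ->.
by rewrite (phi_skew ha) (phi_xi ha) gval0l oppr0 mulr0.
Qed.

(** The number 2 here is twice the area of the pair [e1], [phi e1]; it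
    keeps [N] from vanishing. *)
Lemma connection_contact q : U q -> G i1 i0 i2 q - G i2 i0 i1 q = -2.
Proof.
move=> Uq; have [u1 p1] := he.2 q Uq; rewrite (contact_frame_skew i1 i2 Uq).
rewrite /contact_frame /= (phi_phi_perp ha p1) gvalNr u1; ring.
Qed.

Lemma riemann_contact_frame i j k l q : U q -> riemann_coef g nabla E q i j k l =
  structure_riemann (fun i j k => G i j k q) (fun a i j k => fderiv (E a) (connection_coef g nabla E i j k) q) i j k l.
Proof. exact: (riemann_structure hg hn oU sE oE). Qed.

Let D q a i j k := fderiv (E a) (connection_coef g nabla E i j k) q.

Let Gskew q : U q -> forall i j k, G i k j q = - G i j k q.
Proof. by move=> Uq i j k; exact: (connection_skew hg hn oU sE oE). Qed.

Let Dskew q : U q -> forall a i j k, D q a i k j = - D q a i j k.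
Proof. by move=> Uq a i j k; exact: (fderiv_connection_skew hg hn oU sE oE). Qed.

Let Dcst q a i j k (r : R) : U q -> (forall q', U q' -> G i j k q' = r) -> D q a i j k = 0.
Proof. by move=> Uq H; exact: (fderiv_locally_cst oU _ Uq H). Qed.

Let sG i j k : smooth_fun U (connection_coef g nabla E i j k).
Proof. exact: (smooth_connection hg hn oU sE). Qed.

Lemma nabla_xi_trace q : U q -> G i1 i0 i1 q + G i2 i0 i2 q = 0.
Proof.
move=> Uq.
apply: (trace_identity (Gskew Uq) (Dskew Uq) (fun k => connection_xi_xi k Uq)
  (fun a k => Dcst a Uq (connection_xi_xi k)) _ (connection_contact Uq)).
- apply/eqP; rewrite -subr_eq0; apply/eqP.
  rewrite -(fderivB oU _ (sG i1 i0 i2) (sG i2 i0 i1) Uq).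
  exact: (fderiv_locally_cst oU _ Uq connection_contact).
- rewrite -!(riemann_contact_frame _ _ _ _ Uq).
  exact: (riemann_bianchi hn oU sE i0 i1 i2 i0 Uq).
Qed.

Lemma ricci_xi j q : U q -> \sum_i riemann_coef g nabla E q i i0 j i = 0.
Proof.
move=> Uq; rewrite -[RHS](hric (E j q) (oE Uq)).
by apply: eq_bigr => i _; exact: esym (curv4_frame hg hn oU sE oE i i0 j i Uq).
Qed.

Lemma nabla_xi_nilpotent q : U q -> G i1 i0 i1 q ^+ 2 + G i1 i0 i2 q * G i2 i0 i1 q = 0.
Proof.
move=> Uq.
apply: (nilpotency_identity (Gskew Uq) (fun k => connection_xi_xi k Uq)
  (fun a k => Dcst a Uq (connection_xi_xi k)) _ (nabla_xi_trace Uq)).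
- rewrite -(fderivD Uq (sG i1 i0 i1) (sG i2 i0 i2)).
  exact: (fderiv_locally_cst oU _ Uq nabla_xi_trace).
- by have := ricci_xi i0 Uq; rewrite sum3 !(riemann_contact_frame _ _ _ _ Uq).
Qed.

(** A trace-free operator on a plane with vanishing determinant has square zero. *)
Lemma nabla_xi_square i q : U q -> nabla (nabla (E i) xi) xi q = 0.
Proof.
move=> Uq.
have sX := smooth_xi U.
have sW := smooth_nabla hn oU (sE i) sX.
have -> : nabla (nabla (E i) xi) xi q = nabla (fun r => \sum_k G i i0 k r *: E k r) xi q.
  apply: (nabla_ext hn oU sW sX _ _ Uq) => // r Ur.
  exact: (nabla_frame nabla hg oE i i0 Ur).
rewrite (nabla_suml hn oU (fun k => sG i i0 k) sE sX Uq).
under eq_bigr => k _ do rewrite (nabla_frame nabla hg oE k i0 Uq) scaler_sumr.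
rewrite exchange_big big1 // => l _.
under eq_bigr => k _ do rewrite scalerA.
rewrite -scaler_suml sum3.
suff -> : G i i0 i0 q * G i0 i0 l q + G i i0 i1 q * G i1 i0 l q
          + G i i0 i2 q * G i2 i0 l q = 0 by rewrite scale0r.
have aux (H : 'I_3 -> 'I_3 -> 'I_3 -> R) : (forall k, H k i0 i0 = 0) ->
    (forall k, H i0 i0 k = 0) -> H i1 i0 i1 + H i2 i0 i2 = 0 ->
    H i1 i0 i1 ^+ 2 + H i1 i0 i2 * H i2 i0 i1 = 0 ->
    forall i l, H i i0 i0 * H i0 i0 l + H i i0 i1 * H i1 i0 l + H i i0 i2 * H i2 i0 l = 0.
  move=> Hp Hx Htr Hsq; have Hd : H i2 i0 i2 = - H i1 i0 i1 by lra.
  move=> i' l'; rewrite Hp mul0r add0r.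
  elim/ord3_ind: i'; elim/ord3_ind: l'; rewrite ?Hp ?Hx ?Hd; nra.
exact: (aux (fun i j k => G i j k q) (fun k => connection_xi_perp k Uq) (fun k => connection_xi_xi k Uq)
  (nabla_xi_trace Uq) (nabla_xi_nilpotent Uq)).
Qed.

(** If [phi e1] is in the kernel of [N], then [N] has constant coefficients.
    The Bianchi identity relates the components of [R (e1, phi e1) xi] to the
    Ricci components which vanish by hypothesis, and [first_order_identity] shows
    that the former are, up to the factor -2, the rotation coefficients of [e1]
    along the contact plane.  So these vanish too, and only the rotation of [e1]
    along [xi] is left. *)
Lemma riemann_special_frame : (forall q, U q -> nabla (E i2) xi q = 0) -> forall q, U q ->
  [/\ riemann_coef g nabla E q i0 i1 i0 i1 = 2 * G i0 i1 i2 q, riemann_coef g nabla E q i0 i1 i0 i2 = 0,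
      riemann_coef g nabla E q i0 i2 i0 i1 = 0, riemann_coef g nabla E q i0 i2 i0 i2 = - 2 * G i0 i1 i2 q &
      riemann_coef g nabla E q i1 i2 i1 i2 = - 2 * G i0 i1 i2 q] /\
  [/\ riemann_coef g nabla E q i0 i1 i1 i2 = 0, riemann_coef g nabla E q i0 i2 i1 i2 = 0,
      riemann_coef g nabla E q i1 i2 i0 i1 = 0 & riemann_coef g nabla E q i1 i2 i0 i2 = 0].
Proof.
move=> N2.
have G2 k q : U q -> G i2 i0 k q = 0 by move=> Uq; rewrite /connection_coef N2 // gval0l.
have G12 q : U q -> G i1 i0 i2 q = -2.
  by move=> Uq; have := connection_contact Uq; rewrite G2 // subr0.
have G11 q : U q -> G i1 i0 i1 q = 0.
  by move=> Uq; have := nabla_xi_trace Uq; rewrite G2 // addr0.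
have D1 q : U q -> forall a k, D q a i1 i0 k = 0.
  move=> Uq a k; elim/ord3_ind: k.
  - exact: (Dcst a Uq (connection_xi_perp i1)).
  - exact: (Dcst a Uq G11).
  - exact: (Dcst a Uq G12).
have D2 q : U q -> forall a k, D q a i2 i0 k = 0.
  by move=> Uq a k; exact: (Dcst a Uq (G2 k)).
have anti i j k l q (Uq : U q) := riemann_antisym hn oU sE i j k l Uq.
have skew i j k l q (Uq : U q) := riemann_skew hg hn oU sE oE i j k l Uq.
have Rii i k l q : U q -> riemann_coef g nabla E q i i k l = 0.
  by move=> Uq; have := anti i i k l q Uq; lra.
have Rkk i j k q : U q -> riemann_coef g nabla E q i j k k = 0.
  by move=> Uq; have := skew i j k k q Uq; lra.
have ric1 q : U q -> riemann_coef g nabla E q i0 i2 i1 i2 = 0.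
  move=> Uq; have := ricci_xi i1 Uq; rewrite sum3 Rii // Rkk // !add0r.
  by rewrite anti // => /eqP; rewrite oppr_eq0 => /eqP.
have ric2 q : U q -> riemann_coef g nabla E q i0 i1 i1 i2 = 0.
  move=> Uq; have := ricci_xi i2 Uq; rewrite sum3 Rii // Rkk // add0r addr0.
  by rewrite anti // skew // opprK.
have sym1 q : U q -> riemann_coef g nabla E q i1 i2 i0 i1 = 0.
  move=> Uq; have := riemann_bianchi hn oU sE i0 i1 i2 i1 Uq.
  by rewrite skew // ric2 // oppr0 add0r Rkk // addr0.
have sym2 q : U q -> riemann_coef g nabla E q i1 i2 i0 i2 = 0.
  move=> Uq; have := riemann_bianchi hn oU sE i0 i1 i2 i2 Uq.
  by rewrite Rkk // add0r (anti i0 i2 i1 i2) // ric1 // oppr0 addr0.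
have foi q (Uq : U q) := first_order_identity (Gskew Uq) (fun k => connection_xi_xi k Uq)
  (fun k => G2 k q Uq) (D2 q Uq) (G11 q Uq) (G12 q Uq) (D1 q Uq).
have n2 : (-2 : R) != 0 by rewrite oppr_eq0 pnatr_eq0.
have Gd q : U q -> G i2 i1 i2 q = 0.
  move=> Uq; have [+ _] := foi q Uq.
  rewrite -(riemann_contact_frame _ _ _ _ Uq) sym1 // => /eqP.
  by rewrite eq_sym mulf_eq0 (negbTE n2) => /eqP.
have Gb q : U q -> G i1 i1 i2 q = 0.
  move=> Uq; have [_ +] := foi q Uq.
  rewrite -(riemann_contact_frame _ _ _ _ Uq) sym2 // => /eqP.
  by rewrite eq_sym mulf_eq0 (negbTE n2) => /eqP.
move=> q Uq; split; last by split; [exact: ric2|exact: ric1|exact: sym1|exact: sym2].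
rewrite !(riemann_contact_frame _ _ _ _ Uq).
exact: (curvature_identities (Gskew Uq)
  (fun k => connection_xi_xi k Uq) (fun a k => Dcst a Uq (connection_xi_xi k))
  (fun k => G2 k q Uq) (D2 q Uq) (G11 q Uq) (G12 q Uq) (D1 q Uq)
  (Gb q Uq) (Gd q Uq) (fun a => Dcst a Uq Gb) (fun a => Dcst a Uq Gd)).
Qed.

End Adapted.

Lemma adapted_exists p (V : set M) (W : M -> 'cV[R]_3) : open V -> V p -> smooth_field V W ->
  W p != 0 -> (forall q, V q -> gval g q (W q) (xi q) = 0) ->
  exists U (a : M -> R), [/\ open U, U p, U `<=` V, smooth_fun U a &
    adapted U (fun q => a q *: W q)].
Proof.
move=> oV Vp sW Wp Wperp.
have [U [a [oU Up UV sa aP]]] := normalize hg oV Vp sW Wp.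
have sZ := smooth_fieldZ oU sa (smooth_field_sub UV sW).
exists U, a; split; [exact: oU|exact: Up|exact: UV|exact: sa|split; first exact: sZ].
move=> q Uq; split; first by rewrite gvalZl gvalZr mulrA aP.
by rewrite gvalZl (Wperp q (UV q Uq)) mulr0.
Qed.

(** [phi] is not zero in dimension three, since [phi^2] is minus the identity up to
    a rank one term; normalise a field in its image. *)
Lemma exists_adapted p : exists U e1, [/\ open U, U p & adapted U e1].
Proof.
have [v pv] : exists v : 'cV[R]_3, phi p *m v != 0.
  apply: contrapT => H.
  have phi0 (v : 'cV[R]_3) : phi p *m v = 0 by apply/eqP/negPn/negP => nv; apply: H; exists v.
  have vE v : v = form_val eta p v *: xi p.
    have := acm_phi2 ha p v; rewrite !phi0 => /eqP.
    by rewrite eq_sym addrC subr_eq0 => /eqP.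
  have E i j : (j == i)%:R = form_val eta p (delta_mx i ord0) * xi p j ord0.
    by have := congr1 (fun w : 'cV_3 => w j ord0) (vE (delta_mx i ord0)); rewrite !mxE eqxx andbT.
  have := E i0 i0; have := E i1 i0; have := E i1 i1; rewrite !eqxx /=.
  move: (form_val _ _ _) (form_val _ _ _) (xi p i0 ord0) (xi p i1 ord0) => a b x y.
  move=> by1 bx0 ax1; have : b * y * (a * x) = 1 by rewrite -by1 -ax1 mulr1.
  have -> : b * y * (a * x) = a * y * (b * x) by ring.
  by rewrite -bx0 mulr0 => /eqP; rewrite eq_sym oner_eq0.
pose V := chart_dom (chart_at p).
have oV : open V := @chart_dom_open _ _ _ _.
have Vp : V p by exact: chart_at_dom.
have sW : smooth_field V (fun q => phi q *m extend p v q).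
  exact: (acm_phi_smooth ha oV (smooth_extend p v)).
have Wp : phi p *m extend p v p != 0 by rewrite extend_at.
have [U [a [oU Up _ _ aU]]] := adapted_exists oV Vp sW Wp (fun q _ => phi_perp ha q _).
by exists U, (fun q => a q *: (phi q *m extend p v q)).
Qed.

(** Normalise a nonzero field [W = N E_i] in the image of [N].  The first vector has
    to be [- phi W], because [phi] maps it to [W]. *)
Lemma exists_special p : exists U e1, [/\ open U, U p, adapted U e1 &
  forall q, U q -> nabla (fun r => phi r *m e1 r) xi q = 0].
Proof.
have [V [e1 [oV Vp aV]]] := exists_adapted p.
pose E := contact_frame e1.
have [i Wi] : exists i, nabla (E i) xi p != 0.
  apply: contrapT => H.
  have N0 i : nabla (E i) xi p = 0 by apply/eqP/negPn/negP => nv; apply: H; exists i.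
  have := connection_contact oV aV Vp; rewrite /connection_coef -!/(E _) !N0 !gval0l subrr => /eqP.
  by rewrite eq_sym oppr_eq0 pnatr_eq0.
pose W := nabla (E i) xi.
have sE := smooth_contact_frame oV aV.
have sW : smooth_field V W := smooth_nabla hn oV (sE i) (smooth_xi V).
have perp q : V q -> gval g q (W q) (xi q) = 0 by move=> Vq; exact: (connection_xi_perp oV aV i Vq).
have sW1 : smooth_field V (fun q => - (phi q *m W q)).
  exact: (smooth_fieldN oV (acm_phi_smooth ha oV sW)).
have W1p : - (phi p *m W p) != 0.
  apply/eqP => /eqP; rewrite oppr_eq0 => /eqP H0.
  have := phi_phi_perp ha (perp p Vp); rewrite H0 mulmx0 => /eqP.
  by rewrite eq_sym oppr_eq0 (negbTE Wi).
have W1perp q : V q -> gval g q (- (phi q *m W q)) (xi q) = 0.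
  by move=> _; rewrite gvalNl (phi_perp ha) oppr0.
have [U [a [oU Up UV sa aU]]] := adapted_exists oV Vp sW1 W1p W1perp.
exists U, (fun q => a q *: - (phi q *m W q)); split => // q Uq.
have sWU := smooth_field_sub UV sW.
transitivity (nabla (fun r => a r *: W r) xi q).
  apply: (nabla_ext hn oU (acm_phi_smooth ha oU aU.1) (smooth_xi U) _ _ Uq); last by [].
  move=> r Ur; rewrite -scalemxAr mulmxN (phi_phi_perp ha (perp r (UV r Ur))).
  by rewrite opprK.
rewrite (nablaZl hn oU sa sWU (smooth_xi U) Uq).
by rewrite (nabla_xi_square oV aV i (UV q Uq)) scaler0.
Qed.

End Contact3.

(** * The normal form of the curvature and its consequences *)

Lemma skew_form3_ext (R : realType) (F H : 'I_3 -> 'I_3 -> R) :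
  (forall i j, F j i = - F i j) -> (forall i j, H j i = - H i j) ->
  F i0 i1 = H i0 i1 -> F i0 i2 = H i0 i2 -> F i1 i2 = H i1 i2 ->
  forall i j, F i j = H i j.
Proof.
move=> Fs Hs e01 e02 e12.
have F0 i : F i i = 0 by have := Fs i i; lra.
have H0 i : H i i = 0 by have := Hs i i; lra.
move=> i j; elim/ord3_ind: i; elim/ord3_ind: j; rewrite ?F0 ?H0 //.
- by rewrite Fs Hs e01.
- by rewrite Fs Hs e02.
- by rewrite Fs Hs e12.
Qed.

(** The Gram matrix of [reflected_gval] in the special frame. *)
Definition reflection_sign (R : realType) (i j : 'I_3) : R :=
  if i == j then (if i == i2 then -1 else 1) else 0.

Section Algebra.
Variables (R : realType) (M : manifold R 3) (g : M -> 'M[R]_3).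
Variable nabla : (M -> 'cV[R]_3) -> (M -> 'cV[R]_3) -> (M -> 'cV[R]_3).
Hypothesis hg : riemannian_metric g.
Variables (p : M) (t : 'cV[R]_3) (k : R).
Hypothesis t1 : gval g p t t = 1.

(** The inner product of [u] with the image of [v] under the reflection that changes the
    sign of the unit vector [t]. *)
Definition reflected_gval u v : R := gval g p u v - 2 * (gval g p u t * gval g p v t).

Local Notation B := reflected_gval.
Local Notation gp := (gval g p).

Hypothesis curv4E : forall u v w z,
  curv4 g nabla p u v w z = k * (B v w * B u z - B u w * B v z).

Variable e : 'I_3 -> 'cV[R]_3.
Hypothesis oe : orthonormal g p e.

Lemma reflected_gvalC u v : B u v = B v u.
Proof. by rewrite /reflected_gval (metric_sym hg p u v) [gp u t * _]mulrC. Qed.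

(** The reflection is an isometry. *)
Lemma reflected_parseval u v : \sum_i B u (e i) * B v (e i) = gp u v.
Proof.
have P a b := parseval hg a b oe.
transitivity (gp u v - 2 * gp v t * gp u t - 2 * gp u t * gp v t
              + 4 * (gp u t * gp v t) * gp t t); last by rewrite t1; ring.
rewrite (P u v) (P u t) (P v t) (P t t) -(P u t) -(P v t).
have -> : \sum_i B u (e i) * B v (e i) = \sum_i (gp u (e i) * gp v (e i)
   - 2 * gp v t * (gp u (e i) * gp t (e i)) - 2 * gp u t * (gp v (e i) * gp t (e i))
   + 4 * (gp u t * gp v t) * (gp t (e i) * gp t (e i))).
  apply: eq_bigr => i _; rewrite /reflected_gval (metric_sym hg p (e i) t).
  by move: (gp u t) (gp v t) (gp u (e i)) (gp v (e i)) (gp t (e i)) => a b c d f; ring.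
by rewrite big_split !sumrB /= -!mulr_sumr -!P; ring.
Qed.

Lemma reflected_trace : \sum_i B (e i) (e i) = 1.
Proof.
rewrite /reflected_gval sumrB -mulr_sumr.
have -> : \sum_i gp (e i) t * gp (e i) t = 1.
  rewrite -t1 (parseval hg t t oe); apply: eq_bigr => i _.
  by rewrite (metric_sym hg p (e i) t).
by rewrite sum3 !oe !eqxx /=; ring.
Qed.

Lemma ricci_reflected u v : ricci g nabla p e u v = - 2 * k * (gp u t * gp v t).
Proof.
rewrite /ricci.
under eq_bigr => i _ do rewrite curv4E mulrBr.
rewrite sumrB -!mulr_sumr reflected_trace.
have -> : \sum_i B (e i) v * B u (e i) = gp u v.
  rewrite -reflected_parseval; apply: eq_bigr => i _.
  by rewrite mulrC (reflected_gvalC (e i) v).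
by rewrite mulr1 /reflected_gval; ring.
Qed.

Lemma rbreve_reflected u v : rbreve g nabla p e u v = 4 * k ^+ 2 * gp u v.
Proof.
rewrite /rbreve.
have inner i j : \sum_l curv4 g nabla p u (e i) (e j) (e l) * curv4 g nabla p v (e i) (e j) (e l)
  = k ^+ 2 * (gp u v * (B (e i) (e j) * B (e i) (e j))
     - gp u (e i) * (B (e i) (e j) * B v (e j)) - gp v (e i) * (B u (e j) * B (e i) (e j))
     + (i == i)%:R * (B u (e j) * B v (e j))).
  have -> : gp u v = \sum_l B u (e l) * B v (e l) by rewrite reflected_parseval.
  have -> : gp u (e i) = \sum_l B u (e l) * B (e i) (e l) by rewrite reflected_parseval.
  have -> : gp v (e i) = \sum_l B v (e l) * B (e i) (e l) by rewrite reflected_parseval.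
  have -> : (i == i)%:R = \sum_l B (e i) (e l) * B (e i) (e l) :> R by rewrite reflected_parseval oe.
  rewrite !mulr_suml -!sumrB -big_split mulr_sumr /=; apply: eq_bigr => l _.
  rewrite !curv4E.
  move: (B (e i) (e j)) (B u (e l)) (B u (e j)) (B (e i) (e l)) (B v (e l)) (B v (e j)).
  by move=> a b c d f h; ring.
have middle i : \sum_j \sum_l curv4 g nabla p u (e i) (e j) (e l) * curv4 g nabla p v (e i) (e j) (e l)
  = k ^+ 2 * (2 * gp u v - 2 * (gp u (e i) * gp v (e i))).
  under eq_bigr => j _ do rewrite inner.
  rewrite -mulr_sumr big_split !sumrB /= -!mulr_sumr !reflected_parseval oe eqxx.
  by rewrite (metric_sym hg p (e i) v) /=; ring.
under eq_bigr => i _ do rewrite middle.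
rewrite -mulr_sumr sumrB -[X in _ - X]mulr_sumr -(parseval hg u v oe) sum3.
by ring.
Qed.

Lemma curv_norm2_reflected : curv_norm2 g nabla p e = 12 * k ^+ 2.
Proof.
rewrite /curv_norm2.
transitivity (\sum_i rbreve g nabla p e (e i) (e i)).
  by do 4!apply: eq_bigr => ? _; rewrite expr2.
by rewrite sum3 !rbreve_reflected !oe !eqxx /=; ring.
Qed.

End Algebra.

Section Main.
Variables (R : realType) (M : manifold R 3).
Variables (phi : M -> 'M[R]_3) (xi : M -> 'cV[R]_3) (eta : M -> 'rV[R]_3) (g : M -> 'M[R]_3).
Variable nabla : (M -> 'cV[R]_3) -> (M -> 'cV[R]_3) -> (M -> 'cV[R]_3).
Hypothesis hc : contact_metric phi xi eta g.
Hypothesis hn : levi_civita g nabla.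
Hypothesis hric : forall p e v, orthonormal g p e -> ricci g nabla p e (xi p) v = 0.

Let ha : almost_contact_metric phi xi eta g := cm_almost hc.
Let hg : riemannian_metric g := acm_metric ha.

(** In the special frame the reflected form is diagonal with entries 1, 1, -1, and
    [t] is [phi e1].  Both sides are skew in the first and in the last pair of
    arguments, so the nine components computed in that frame suffice. *)
Lemma curvature_normal_form p : exists t k,
  [/\ gval g p t t = 1, gval g p (xi p) t = 0, (exists e, orthonormal g p e) &
  forall u v w z, curv4 g nabla p u v w z =
    k * (reflected_gval g p t v w * reflected_gval g p t u z
         - reflected_gval g p t u w * reflected_gval g p t v z)].
Proof.
have [U [e1 [oU Up aU N2]]] := exists_special hc hn hric p.
set E := contact_frame phi xi e1.
have sE := smooth_contact_frame hc oU aU; have oE := orthonormal_contact_frame hc aU.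
have oEp := oE p Up.
set t := E i2 p; set k := - 2 * connection_coef g nabla E i0 i1 i2 p.
exists t, k; split.
- exact: oEp i2 i2.
- exact: oEp i0 i2.
- by exists (fun i => E i p).
pose b := @reflection_sign R.
have RE i j l m : riemann_coef g nabla E p i j l m = k * (b j l * b i m - b i l * b j m).
  have [[r1 r2 r3 r4 r5] [r6 r7 r8 r9]] := riemann_special_frame hc hn hric oU aU N2 Up.
  apply: (@skew_form3_ext _ (fun i j => riemann_coef g nabla E p i j l m)
    (fun i j => k * (b j l * b i m - b i l * b j m))); last 3 first.
  - apply: (@skew_form3_ext _ (fun l m => riemann_coef g nabla E p i0 i1 l m)
      (fun l m => k * (b i1 l * b i0 m - b i0 l * b i1 m))).
    + by move=> a c; exact: (riemann_skew hg hn oU sE oE).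
    + by move=> a c; ring.
    + by rewrite r1 /k /b /reflection_sign /=; ring.
    + by rewrite r2 /k /b /reflection_sign /=; ring.
    + by rewrite r6 /k /b /reflection_sign /=; ring.
  - apply: (@skew_form3_ext _ (fun l m => riemann_coef g nabla E p i0 i2 l m)
      (fun l m => k * (b i2 l * b i0 m - b i0 l * b i2 m))).
    + by move=> a c; exact: (riemann_skew hg hn oU sE oE).
    + by move=> a c; ring.
    + by rewrite r3 /k /b /reflection_sign /=; ring.
    + by rewrite r4 /k /b /reflection_sign /=; ring.
    + by rewrite r7 /k /b /reflection_sign /=; ring.
  - apply: (@skew_form3_ext _ (fun l m => riemann_coef g nabla E p i1 i2 l m)
      (fun l m => k * (b i2 l * b i1 m - b i1 l * b i2 m))).
    + by move=> a c; exact: (riemann_skew hg hn oU sE oE).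
    + by move=> a c; ring.
    + by rewrite r8 /k /b /reflection_sign /=; ring.
    + by rewrite r9 /k /b /reflection_sign /=; ring.
    + by rewrite r5 /k /b /reflection_sign /=; ring.
  - by move=> a c; exact: (riemann_antisym hn oU sE).
  - by move=> a c; ring.
move=> u v w z; rewrite (curv4_expand hg hn oU sE oE u v w z Up).
have BE a c : reflected_gval g p t a c = \sum_i \sum_j b i j * (gval g p a (E i p) * gval g p c (E j p)).
  rewrite /reflected_gval (parseval hg a c oEp) !sum3 /b /reflection_sign /= -/t.
  move: (gval g p a (E i0 p)) (gval g p a (E i1 p)) (gval g p a t).
  by move: (gval g p c (E i0 p)) (gval g p c (E i1 p)) (gval g p c t) => *; ring.
rewrite !BE.
have aux (u' v' w' z' : 'I_3 -> R) (F : 'I_3 -> 'I_3 -> 'I_3 -> 'I_3 -> R) :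
   (forall i j l m, F i j l m = k * (b j l * b i m - b i l * b j m)) ->
   \sum_i \sum_j \sum_l \sum_m u' i * v' j * w' l * z' m * F i j l m
   = k * ((\sum_i \sum_j b i j * (v' i * w' j)) * (\sum_i \sum_j b i j * (u' i * z' j))
        - (\sum_i \sum_j b i j * (u' i * w' j)) * (\sum_i \sum_j b i j * (v' i * z' j))).
  move=> FE; rewrite !sum3 !FE /b /reflection_sign /=.
  move: (u' i0) (u' i1) (u' i2) (v' i0) (v' i1) (v' i2) => u0 u1 u2 v0 v1 v2.
  move: (w' i0) (w' i1) (w' i2) (z' i0) (z' i1) (z' i2) => w0 w1 w2 z0 z1 z2.
  ring.
exact: (aux (fun i => gval g p u (E i p)) (fun i => gval g p v (E i p))
  (fun i => gval g p w (E i p)) (fun i => gval g p z (E i p)) (riemann_coef g nabla E p) RE).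
Qed.

End Main.

Theorem theorem5p1 (R : realType) (M : manifold R 3)
    (phi : M -> 'M[R]_3) (xi : M -> 'cV[R]_3)
    (eta : M -> 'rV[R]_3) (g : M -> 'M[R]_3)
    (nabla : (M -> 'cV[R]_3) -> (M -> 'cV[R]_3) -> (M -> 'cV[R]_3))
    (Q : M -> 'M[R]_3)
    (hcontact : contact_metric phi xi eta g)
    (hnabla : levi_civita g nabla)
    (hQ : ricci_operator g nabla Q)
    (hQxi : forall p : M, Q p *m xi p = 0) :
  (forall p : M, (\rank (Q p) <= 1)%N) /\
  (flat nabla \/ (weakly_einstein g nabla /\ ~ einstein g nabla)).
Proof.
have hg : riemannian_metric g := acm_metric (cm_almost hcontact).
have hric p e v : orthonormal g p e -> ricci g nabla p e (xi p) v = 0.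
  by move=> oe; rewrite -(hQ p e oe) hQxi gval0l.
have nf := curvature_normal_form hcontact hnabla hric.
split=> [p|].
  have [t [k [t1 _ [e oe] curv4E]]] := nf p.
  have QE (u : 'cV[R]_3) : Q p *m u = (- 2 * k * gval g p u t) *: t.
    apply: (@gval_inj _ _ _ _ hg p) => w.
    rewrite (hQ p e oe) (ricci_reflected hg t1 curv4E oe) gvalZl (metric_sym hg p t w).
    by rewrite mulrA.
  have -> : Q p = t *m ((- 2 * k) *: (t^T *m g p)).
    apply/matrixP => i j.
    have := congr1 (fun w : 'cV_3 => w i ord0) (QE (delta_mx j ord0)).
    rewrite -colE mxE => ->.
    rewrite (metric_sym hg p) /gval -colE.
    move: (t^T *m g p) => S.
    by rewrite !mxE big_ord1 !mxE; ring.
  exact: leq_trans (mxrankM_maxl _ _) (rank_leq_col _).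
have [fl|nfl] := pselect (flat nabla); [by left|right; split].
  move=> p e oe u v; have [t [k [t1 _ _ curv4E]]] := nf p.
  rewrite (rbreve_reflected hg t1 curv4E oe) (curv_norm2_reflected hg t1 curv4E oe).
  by field.
move=> [lambda Ein]; apply: nfl => p u v w.
have [t [k [t1 txi [e oe] curv4E]]] := nf p.
have x1 := xi_unit (cm_almost hcontact) p.
have l0 : lambda = 0.
  by have := Ein p e oe (xi p) (xi p); rewrite hric // x1 mulr1.
have k0 : k = 0.
  have := Ein p e oe t t; rewrite (ricci_reflected hg t1 curv4E oe) t1 l0 mul0r !mulr1 => /eqP.
  by rewrite mulf_eq0 oppr_eq0 pnatr_eq0 /= => /eqP.
apply: (@gval_inj _ _ _ _ hg p) => z; rewrite gval0l.
by have := curv4E u v w z; rewrite k0 mul0r.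
Qed.
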